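(* Let $m,n\in\mathbb{N}$ with $m,n\geq 3$ and $n\not\equiv 2\pmod 4$, and let $\Lambda$ be a cyclotomic model set with underlying $\mathbb{Z}$-module $\mathcal{O}_n$. Let $\mathcal{S}:=\{8,9,12\}\cup\{2p+1 \mid p\in\mathcal{P}_{\mathrm{SG}}\}$. Then: (a) If $n\in\{3,4\}$, there is an affinely regular $m$-gon in $\Lambda$ if and only if $m\in\{3,4,6\}$. (b) If $n\in\mathcal{S}$, there is an affinely regular $m$-gon in $\Lambda$ if and only if $m\in\{3,4,6,n\}$ in case $n=8$ or $n=12$, and $m\in\{3,4,6,n,2n\}$ otherwise.
   Context: $\mathbb{N}=\{1,2,3,\dots\}$; $\mathbb{R}^2$ is identified with $\mathbb{C}$. $\mathcal{P}_{\mathrm{SG}}$ is the set of Sophie Germain primes, i.e. primes $p$ such that $2p+1$ is also prime. For $n\in\mathbb{N}$: $\zeta_n:=e^{2\pi i/n}$, $\mathbb{K}_n:=\mathbb{Q}(\zeta_n)$ and $\mathcal{O}_n:=\mathbb{Z}[\zeta_n]$; $\phi$ is Euler's function. Cyclotomic model sets: let $n\ge 3$. Choose automorphisms $\sigma_1=\mathrm{id},\sigma_2,\dots,\sigma_{\phi(n)/2}$ of $\mathbb{K}_n/\mathbb{Q}$ by picking exactly one from each pair of complex conjugate automorphisms, and let the star map $\star:\mathcal{O}_n\to(\mathbb{R}^2)^{\phi(n)/2-1}$ be $z\mapsto z^\star:=(\sigma_2(z),\dots,\sigma_{\phi(n)/2}(z))$ (for $n\in\{3,4,6\}$ the target is the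 one-point space $\{0\}$ and the star map is the zero map). A window is a set $W\subset(\mathbb{R}^2)^{\phi(n)/2-1}$ with $\emptyset\neq \operatorname{int}(W)\subset W\subset\overline{\operatorname{int}(W)}$ and $\overline{\operatorname{int}(W)}$ compact. A cyclotomic model set with underlying $\mathbb{Z}$-module $\mathcal{O}_n$ is a set of the form $\Lambda=t+\{z\in\mathcal{O}_n \mid z^\star\in W\}$ with $t\in\mathbb{R}^2$, $W$ a window, and $\star$ any such star map. A polygon in a set $S\subset\mathbb{R}^2$ is a convex polygon (convex hull of a finite set of points) all of whose vertices lie in $S$. Regular polygons are assumed to be planar, non-degenerate and convex. An affinely regular polygon is the image of a regular polygon under a non-singular affine transformation $z\mapsto Az+t$ of the plane ($A$ an invertible real $2\times 2$ matrix, $t\in\mathbb{R}^2$); an affinely regular $m$-gon is one with exactly $m$ vertices. *)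

(* Defs.v *)
From HB Require Import structures.
From mathcomp Require Import all_boot all_order all_algebra.
From mathcomp Require Export complex.
From mathcomp Require Import all_classical all_reals all_analysis.

Set Implicit Arguments.
Unset Strict Implicit.
Unset Printing Implicit Defensive.

Import Order.TTheory GRing.Theory Num.Theory numFieldNormedType.Exports.
Local Open Scope classical_set_scope.
Local Open Scope ring_scope.

(* Keep these the R-valued projections of R[i], not the R[i]-valued 'Re, 'Im. *)
Local Notation Re := complex.Re.
Local Notation Im := complex.Im.

(* The plane R^2 is identified with the field of complex numbers R[i]. *)

Definition zeta {R : realType} (n : nat) : R[i] :=
  Complex (cos (2 * pi / n%:R)) (sin (2 * pi / n%:R)).

Definition cyclotomic_field {R : realType} (n : nat) : set R[i] :=
  smallest [set S : set R[i] | GRing.divring_closed (mem S)] [set zeta n].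

Definition cyclotomic_ring {R : realType} (n : nat) : set R[i] :=
  smallest [set S : set R[i] | GRing.subring_closed (mem S)] [set zeta n].

(* A self-map of R[i] represents an automorphism through its restriction to
   [cyclotomic_field n]; its values elsewhere are irrelevant. *)
Definition cyclotomic_aut {R : realType} (n : nat) (s : R[i] -> R[i]) : Prop :=
  let K := @cyclotomic_field R n in
  [/\ set_bij K K s,
      {in K &, {morph s : x y / x + y}},
      {in K &, {morph s : x y / x * y}} &
      forall q : rat, s (ratr q) = ratr q].

(* Indices run over 1, ..., phi(n)/2; the other values of [s] are irrelevant. *)
Definition aut_selection {R : realType} (n : nat) (s : nat -> R[i] -> R[i]) :
    Prop :=
  let K := @cyclotomic_field R n in
  let idx (j : nat) := (1 <= j <= (totient n)./2)%N in
  [/\ forall j, idx j -> cyclotomic_aut n (s j),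
      {in K, s 1%N =1 id} &
      forall u, cyclotomic_aut n u ->
        exists! j, idx j /\
          ({in K, s j =1 u} \/ {in K, s j =1 (fun z => conjc (u z))})].

(* [R[i]^o] is R[i] with its norm topology; row vectors over it carry the
   product topology. *)
Definition star {R : realType} (n : nat) (s : nat -> R[i] -> R[i]) (z : R[i]) :
    'rV[R[i]^o]_((totient n)./2.-1) :=
  \row_j (s j.+2 z : R[i]^o).

Definition window {R : realType} (k : nat) (W : set 'rV[R[i]^o]_k) : Prop :=
  [/\ W° !=set0, W° `<=` W, W `<=` closure W° & compact (closure W°)].

Definition cyclotomic_model_set {R : realType} (n : nat) (L : set R[i]) : Prop :=
  exists (s : nat -> R[i] -> R[i]) (t : R[i])
      (W : set 'rV[R[i]^o]_((totient n)./2.-1)),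
    [/\ aut_selection n s, window W &
        L = [set t + z | z in [set z | cyclotomic_ring n z /\ W (star n s z)]]].

(* [Rcomplex R] is R[i] as a module over R, so that the coefficients of convex
   combinations are real. *)
Definition convex_hull {R : realType} (F : set R[i]) : set R[i] :=
  smallest (@convex_set R (Rcomplex R)) F.

Definition convex_polygon {R : realType} (P : set R[i]) : Prop :=
  exists2 F : set R[i], finite_set F & P = convex_hull F.

(* The vertices are the extreme points. *)
Definition vertices {R : realType} (P : set R[i]) : set R[i] :=
  [set x | P x /\
     forall (a b : R[i]) (k : R), P a -> P b -> 0 < k < 1 ->
       x = (k%:C * a + (1 - k)%:C * b)%C -> a = x /\ b = x].

Definition polygon_in {R : realType} (S P : set R[i]) : Prop :=
  convex_polygon P /\ vertices P `<=` S.

(* Signed area of the parallelogram spanned by a and b. *)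
Definition cross {R : realType} (a b : R[i]) : R := Re a * Im b - Im a * Re b.

Definition angle {R : realType} (a b : R[i]) : R :=
  acos ((Re a * Re b + Im a * Im b) /
        (Normc.normc a * Normc.normc b)).

(* v lists, in counterclockwise order, the vertices of a non-degenerate convex
   polygon: all the other vertices lie strictly to the left of the oriented
   line through two consecutive ones. *)
Definition ccw_convex {R : realType} (k : nat) (v : 'I_k -> R[i]) : Prop :=
  (3 <= k)%N /\
  forall i j : 'I_k, j != i -> j != ordS i ->
    0 < cross (v (ordS i) - v i) (v j - v i).

Definition regular_polygon {R : realType} (Q : set R[i]) : Prop :=
  exists (k : nat) (v : 'I_k -> R[i]),
    [/\ ccw_convex v,
        Q = convex_hull (range v),
        forall i j, Normc.normc (v (ordS i) - v i)
                  = Normc.normc (v (ordS j) - v j) &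
        let interior_angle i :=
          angle (v i - v (ordS i)) (v (ordS (ordS i)) - v (ordS i)) in
        forall i j, interior_angle i = interior_angle j].

Definition affine_map {R : realType} (A : 'M[R]_2) (t z : R[i]) : R[i] :=
  Complex (A 0 0 * Re z + A 0 1 * Im z)
          (A 1 0 * Re z + A 1 1 * Im z) + t.

Definition affinely_regular_polygon {R : realType} (P : set R[i]) : Prop :=
  exists (Q : set R[i]) (A : 'M[R]_2) (t : R[i]),
    [/\ regular_polygon Q, A \in unitmx & P = affine_map A t @` Q].

Definition affinely_regular_gon {R : realType} (m : nat) (P : set R[i]) : Prop :=
  affinely_regular_polygon P /\ (vertices P #= `I_m)%card.

Definition has_affinely_regular_gon {R : realType} (m : nat) (L : set R[i]) :
    Prop :=
  exists P : set R[i], affinely_regular_gon m P /\ polygon_in L P.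

Definition sophie_germain (p : nat) : bool := prime p && prime (2 * p).+1.

Definition setS (n : nat) : Prop :=
  n \in [:: 8; 9; 12] \/ exists2 p, sophie_germain p & n = (2 * p).+1.

(* Main.v *)
(* If an affinely regular m-gon has consecutive vertices p0, p1, p2, p3 in
   t + O_n, then p3 - p0 = (1 + 2 cos (2 pi a / m)) (p2 - p1) for some a prime to
   m, because this holds for the regular m-gon and affine maps preserve ratios
   of parallel vectors.  So w + w^-1 lies in K_n for a primitive m-th root of
   unity w.  By irreducibility of the cyclotomic polynomial of index m n, every
   unit modulo m n that is 1 modulo n must then be 1 or -1 modulo m, which forces
   m in {3, 4, 6}, m | n, or m = 2 d with d an odd divisor of n.

   Conversely, if 2 cos (2 pi / m) lies in O_n, the linear map fixing 1 and
   sending zeta_m to zeta_n puts an affinely regular m-gon into O_n.  The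
   pigeonhole principle gives a nonzero real lam in O_n whose other conjugates
   are as small as desired; the star image of lam * O_n is then correspondingly
   dense, and a translate of the m-gon scaled by lam has its star image in the
   window. *)
From mathcomp Require Import all_boot all_order all_algebra all_field.
Require Import Defs.
From mathcomp Require Import all_classical all_reals all_analysis.
From mathcomp Require Import zify ring lra.

Set Implicit Arguments.
Unset Strict Implicit.
Unset Printing Implicit Defensive.

Import Order.TTheory GRing.Theory Num.Theory numFieldNormedType.Exports.

(** * Units modulo m that lift to units congruent to 1 modulo n *)

(** A Chinese remainder argument for moduli that need not be coprime: the two congruences are
    compatible because they agree modulo [gcdn k n]. *)
Lemma lift_unit (k n a : nat) : (0 < k)%N -> (0 < a)%N -> coprime a k ->
  a = 1 %[mod gcdn k n] ->
  exists b, [/\ b = a %[mod k], b = 1 %[mod n] & coprime b (k * n)].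
Proof.
move=> k0 a0 cak /eqP; rewrite eqn_mod_dvd // => /dvdnP[t et].
have [u _ /dvdnP[v ev]] := Bezoutl n k0.
(* Modulo [k], [u * n] is minus the gcd and [k.-1] stands for -1, so [b] becomes [1 + gcdn k n * t],
   which is [a]. *)
pose b := 1 + n * (u * k.-1 * t).
have bk : b = a %[mod k].
  have : v * t * k + b = u * n * t * k + a.
    have -> : v * t * k = (v * k) * t by lia.
    rewrite /b -ev -{2}(prednK k0); nia.
  by move=> /(congr1 (modn^~ k)); rewrite !modnMDl.
exists b; split => //; first by rewrite /b addnC mulnC modnMDl.
rewrite coprimeMr -(coprime_modl b k) bk coprime_modl cak /=.
by rewrite -(coprime_modl b) /b addnC mulnC modnMDl coprime_modl coprime1n.
Qed.

(** A test unit decides each case: 2 for odd [k], k/2 + 2 for [k] congruent to 2 modulo 4, and k/2 +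
    1 for [k] divisible by 4. Lying strictly between 1 and [k], it has to be k - 1. *)
Lemma units_pm1 (k : nat) : (3 <= k)%N ->
  (forall a, (0 < a)%N -> coprime a k -> a = 1 %[mod k] \/ (k %| a.+1)%N) ->
  k \in [:: 3; 4; 6].
Proof.
move=> k3 H.
have {}H a : (1 < a)%N -> (a < k)%N -> coprime a k -> a.+1 = k.
  move=> a1 ak cak; case: (H a _ cak) => [|/eqP|/dvdn_leq]; [lia| |lia].
  rewrite !modn_small; lia.
have [ok|ek] := boolP (odd k).
  by rewrite -(H 2) // coprime2n.
have [j ej] : exists j, k = j.*2 by exists k./2; lia.
have cop a : coprime a j -> odd a -> coprime a k.
  by move=> caj oa; rewrite ej -muln2 coprimeMr caj coprimen2.
have [oj|ev] := boolP (odd j).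
  have [->//|j3] := eqVneq k 6.
  suff: (j + 2).+1 = k by lia.
  apply: H; [lia..|apply: cop; last lia].
  by rewrite /coprime gcdnC gcdnDl -/(coprime _ _) coprimen2.
have [->//|j2] := eqVneq k 4.
suff: j.+1.+1 = k by lia.
apply: H; [lia..|apply: cop; last lia].
exact: coprimeSn.
Qed.

(** Let d = gcd(k, n). Every unit modulo [k] that is 1 modulo [d] lifts, hence is 1 or -1 modulo
    [k]. For d <= 2 this concerns all units; for d >= 3 the sign -1 is excluded because [d] divides
    [k]. *)
Lemma units_lift_structure (k n : nat) : (3 <= k)%N -> (0 < n)%N ->
  (forall a, coprime a (k * n) -> a = 1 %[mod n] ->
     a = 1 %[mod k] \/ (k %| a.+1)%N) ->
  [\/ k \in [:: 3; 4; 6], (k %| n)%N | exists2 d, odd d && (d %| n)%N & k = 2 * d].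
Proof.
move=> k3 n0 H0; set d := gcdn k n.
have dk : d %| k by exact: dvdn_gcdl.
have dn : d %| n by exact: dvdn_gcdr.
have d0 : 0 < d by rewrite gcdn_gt0 n0 orbT.
have H a : (0 < a)%N -> coprime a k -> a = 1 %[mod d] ->
    a = 1 %[mod k] \/ (k %| a.+1)%N.
  move=> a0 cak ea.
  have [|b [bk bn cb]] := lift_unit _ a0 cak ea; first lia.
  case: (H0 b cb bn) => [|kb]; first by rewrite bk; left.
  by right; rewrite /dvdn -addn1 -modnDml -bk modnDml addn1.
have [d3|d3] := ltnP d 3.
  apply: Or31; apply: units_pm1 => // a a0 cak; apply: H => //.
  have : d = 1 \/ d = 2 by lia.
  case=> ed; first by rewrite ed !modn1.
  have : odd a by rewrite -coprimen2; apply: coprime_dvdr cak; rewrite -ed.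
  rewrite ed; lia.
have {}H a : (0 < a)%N -> coprime a k -> a = 1 %[mod d] -> a = 1 %[mod k].
  move=> a0 cak ea; case: (H a a0 cak ea) => // /(dvdn_trans dk).
  by rewrite /dvdn -addn1 -modnDml ea modnDml modn_small.
(* [k1] gathers the primes dividing [d], [k2] the others, and units can be prescribed independently
   in both. The unit d + 1 forces k1 = d; [k2] is left with a single unit class, so it is 1 or 2. *)
pose k1 := k`_\pi(d); pose k2 := k`_(\pi(d))^'.
have ek : k1 * k2 = k by rewrite partnC //; lia.
have c12 : coprime k1 k2 by exact: coprime_partC.
have k20 : 0 < k2 by exact: part_gt0.
have dk1 : d %| k1 by rewrite -[d](part_pnat_id (pnat_pi d0)) partn_dvd //; lia.
have {}H a1 a2 : coprime a1 k1 -> coprime a2 k2 -> a1 = 1 %[mod d] ->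
    a1 = 1 %[mod k1] /\ a2 = 1 %[mod k2].
  move=> c1 c2 e1; set a := chinese k1 k2 a1 a2.
  have e1' : a = a1 %[mod k1] by exact: chinese_modl.
  have e2' : a = a2 %[mod k2] by exact: chinese_modr.
  have cak : coprime a k.
    by rewrite -ek coprimeMr -coprime_modl e1' -(coprime_modl a) e2' !coprime_modl c1.
  have a0 : 0 < a by case: (a) cak => //; rewrite /coprime gcd0n; lia.
  have := H a a0 cak; rewrite -(modn_dvdm a dk1) e1' modn_dvdm // => /(_ e1) ea.
  split; first by rewrite -e1' -(modn_dvdm a (_ : k1 %| k)) ?ea ?modn_dvdm // -ek dvdn_mulr.
  by rewrite -e2' -(modn_dvdm a (_ : k2 %| k)) ?ea ?modn_dvdm // -ek dvdn_mull.
have c1S : coprime d.+1 k1.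
  rewrite coprime_sym; apply: (@pnat_coprime \pi(d)); first exact: part_pnat.
  by rewrite -coprime_pi' // coprimenS.
have ed : k1 = d.
  apply/eqP; rewrite eqn_dvd dk1 andbT.
  have [] := H d.+1 1 c1S (coprime1n _); first by rewrite -addn1 modnDl.
  by move=> /eqP; rewrite eqn_mod_dvd // subn1.
have [odd2|even2] := boolP (odd k2).
  have c2 : coprime 2 k2 by rewrite coprime2n.
  have [_ /eqP] := H 1 2 (coprime1n _) c2 erefl.
  rewrite eqn_mod_dvd // dvdn1 => /eqP k21.
  by apply: Or32; rewrite -ek k21 muln1 ed.
have [_ /eqP] := H 1 k2.-1 (coprime1n _) (coprimePn k20) erefl.
rewrite eqn_mod_dvd; last lia.
move=> h2.
have k22 : k2 = 2.
  have [k3' | //] : 2 < k2 \/ k2 = 2 by lia.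
  have := dvdn_leq _ h2; lia.
apply: Or33; exists d; last by rewrite -ek ed k22 mulnC.
by rewrite dn andbT -coprimen2 -k22 -{1}ed.
Qed.

Local Open Scope ring_scope.

(** * Conjugate roots of unity *)

(** As ['X^N - 1] is the product of the ['Phi_d] with d | N, some ['Phi_d] vanishes at [x]; then x^d
    = 1, so N | d and d = N. *)
Lemma root_Cyclotomic (F : numFieldType) (N : nat) (x : F) :
  N.-primitive_root x -> root (map_poly intr 'Phi_N) x.
Proof.
move=> px; have N0 := prim_order_gt0 px.
have eP n : (0 < n)%N ->
    \prod_(d <- divisors n) map_poly intr 'Phi_d = 'X^n - 1 :> {poly F}.
  move=> n0; rewrite -rmorph_prod prod_Cyclotomic //.
  by rewrite rmorphB /= map_polyXn rmorph1.
have /factor_theorem [q eq] : root ('X^N - 1) x.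
  by rewrite rootE !hornerE prim_expr_order // subrr.
have : root (\prod_(d <- divisors N) map_poly intr 'Phi_d) x.
  by rewrite eP // eq rootM root_XsubC eqxx orbT.
rewrite rootE horner_prod prodf_seq_eq0 => /hasP[d]; rewrite -dvdn_divisors //= => dN rd.
have d0 : (0 < d)%N by exact: dvdn_gt0 dN.
suff : (N %| d)%N by move=> Nd; rewrite (@eqP _ N d _) ?eqn_dvd ?Nd.
rewrite (prim_order_dvd px) -subr_eq0.
have : root ('X^d - 1) x.
  rewrite -eP // (big_rem d) /= ?rootM ?rootE ?rd //.
  by rewrite -dvdn_divisors.
by rewrite rootE !hornerE.
Qed.

(** Irreducibility is transferred from [algC]: the gcd of [p] and ['Phi_N] over [rat] vanishes at
    [x], so it is not constant and has a root [z] in [algC]. The minimal polynomial of [z] is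
    ['Phi_N], which therefore divides [p]. *)
Lemma root_conj_primitive (F : numFieldType) (N : nat) (x y : F)
    (p : {poly int}) :
  N.-primitive_root x -> N.-primitive_root y ->
  root (map_poly intr p) x -> root (map_poly intr p) y.
Proof.
move=> px py rx; have N0 := prim_order_gt0 px.
have eZ (K : numFieldType) (q : {poly int}) :
    map_poly intr q = map_poly ratr (map_poly intr q : {poly rat}) :> {poly K}.
  by rewrite -map_poly_comp; apply: eq_map_poly => z /=; rewrite ratr_int.
pose P := map_poly intr p : {poly rat}.
pose Phi := map_poly intr 'Phi_N : {poly rat}.
have rg : root (map_poly ratr (gcdp P Phi)) x.
  by rewrite gcdp_map root_gcd -!eZ rx root_Cyclotomic.
have [z rz] : exists z : algC, root (map_poly ratr (gcdp P Phi)) z.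
  apply/closed_rootP; rewrite size_map_poly; apply: contraL rg.
  by move=> /size_poly1P[c c0 ->]; rewrite map_polyC /= rootC fmorph_eq0.
have pz : N.-primitive_root z.
  have [w pw] := C_prim_root_exists N0.
  rewrite -(root_cyclotomic pw) -(Cintr_Cyclotomic pw) eZ.
  by move: rz; rewrite gcdp_map root_gcd => /andP[].
have [q [eq _] rq] := minCpolyP z.
have eqP' : q = Phi.
  apply: (map_poly_inj (ratr : rat -> algC)).
  by rewrite -eq (minCpoly_cyclotomic pz) -(Cintr_Cyclotomic pz) eZ.
have : Phi %| P.
  apply: dvdp_trans (dvdp_gcdl P Phi); rewrite -[X in X %| _]eqP' -rq; exact: rz.
move=> /dvdpP[r er]; rewrite eZ -/P er rmorphM /= rootM.
by rewrite -eZ root_Cyclotomic ?orbT.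
Qed.

Lemma prim_root_neq0 (F : fieldType) (n : nat) (z : F) :
  n.-primitive_root z -> z != 0.
Proof.
move=> pz; apply: contra_eq_neq (prim_expr_order pz) => ->.
by rewrite expr0n gtn_eqF ?(prim_order_gt0 pz) // eq_sym oner_eq0.
Qed.

(** The equation says 1 + w + 1/w = p(z)/q(z). With [w] and [z] written as powers of [x] it is an
    integer polynomial relation in [x], which survives replacing [x] by x^a. If [a] is 1 modulo [n],
    then [z] is fixed, so w^a + w^-a = w + w^-1, that is, (w^a - w)(w^(a+1) - 1) = 0. *)
Lemma cos_quotient_order (F : numFieldType) (k n : nat) (x w z : F)
    (p q : {poly int}) :
  (3 <= k)%N -> (k * n)%N.-primitive_root x ->
  k.-primitive_root w -> n.-primitive_root z ->
  (map_poly intr q).[z] != 0 ->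
  (1 + w + w ^+ 2) * (map_poly intr q).[z] = w * (map_poly intr p).[z] ->
  [\/ k \in [:: 3; 4; 6], (k %| n)%N
    | exists2 d, odd d && (d %| n)%N & k = (2 * d)%N].
Proof.
move=> k3 px pw pz q0 eqpq.
have n0 := prim_order_gt0 pz.
have [b eb] : exists b, w = x ^+ b.
  have [|i ->] := prim_rootP px (_ : w ^+ (k * n) = 1); last by exists i.
  by rewrite exprM (prim_expr_order pw) expr1n.
have [c ec] : exists c, z = x ^+ c.
  have [|i ->] := prim_rootP px (_ : z ^+ (k * n) = 1); last by exists i.
  by rewrite [(k * n)%N]mulnC exprM (prim_expr_order pz) expr1n.
apply: units_lift_structure => // a cak an.
have pxa : (k * n)%N.-primitive_root (x ^+ a).
  by rewrite prim_root_exp_coprime.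
pose G : {poly int} :=
  (1 + 'X^b + 'X^b ^+ 2) * (q \Po 'X^c) - 'X^b * (p \Po 'X^c).
have eG y : (map_poly intr G).[y] = (1 + y ^+ b + (y ^+ b) ^+ 2) *
    (map_poly intr q).[y ^+ c] - y ^+ b * (map_poly intr p).[y ^+ c] :> F.
  rewrite /G !(rmorphB, rmorphD, rmorphM, rmorph1, rmorphXn) /= map_polyX.
  by rewrite !map_comp_poly rmorphXn /= map_polyX !hornerE !horner_comp !hornerE.
have rG : root (map_poly intr G) x.
  by rewrite rootE eG -eb -ec eqpq subrr.
have := root_conj_primitive px pxa rG; rewrite rootE eG.
rewrite ![(x ^+ a) ^+ _]exprAC -eb -ec.
have za : z ^+ a = z by rewrite -(prim_expr_mod pz) an (prim_expr_mod pz).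
rewrite za subr_eq0 => /eqP e.
have : (w ^+ a - w) * (w ^+ a.+1 - 1) = 0.
  apply: (mulIf q0); rewrite mul0r exprSr.
  set Q := _.[z] in e eqpq *; set P := _.[z] in e eqpq *.
  transitivity (w * ((1 + w ^+ a + w ^+ a ^+ 2) * Q - w ^+ a * P)
    - w ^+ a * ((1 + w + w ^+ 2) * Q - w * P)); first by ring.
  by rewrite e eqpq !subrr !mulr0 subrr.
move=> /eqP; rewrite mulf_eq0 !subr_eq0 => /orP[wa|wa].
  by left; apply/eqP; rewrite -(eq_prim_root_expr pw) expr1.
by right; rewrite (prim_order_dvd pw).
Qed.

Local Open Scope classical_set_scope.
Local Notation Re := complex.Re.
Local Notation Im := complex.Im.
Local Notation segpt k a b := (k%:C * a + (1 - k)%:C * b)%C.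

(** * Convex hulls and their vertices *)

Lemma convex_setE (R : realType) (A : set R[i]) :
  @convex_set R (Rcomplex R) A <->
  (forall (a b : R[i]) (k : R), A a -> A b -> 0 < k < 1 -> A (segpt k a b)).
Proof.
have eS (a b : R[i]) (k : {i01 R}) :
    conv k (a : convex_lmodType (Rcomplex R)) b = segpt (k%:num) a b.
  rewrite /conv /=; case: a b => [ar ai] [br bi]. 
  rewrite /unstable.onem; apply/eqP; rewrite eq_complex /=.
  by rewrite !mul0r !subr0 !addr0 !eqxx.
rewrite convex_setW; split => H a b.
  move=> k Aa Ab /andP[k0 k1].
  have := H a b; rewrite !inE => /(_ Aa Ab (Itv01 (ltW k0) (ltW k1)) k0 k1).
  by rewrite inE eS.
rewrite !inE => Aa Ab k k0 k1.
by have := H a b _ Aa Ab (introT andP (conj k0 k1)); rewrite inE eS.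
Qed.

Definition segment_morph (R : realType) (f : R[i] -> R[i]) :=
  forall k a b, f (segpt k a b) = segpt k (f a) (f b).

Lemma convex_hull_ind (R : realType) (F A : set R[i]) :
  (forall (a b : R[i]) (k : R), A a -> A b -> 0 < k < 1 -> A (segpt k a b)) ->
  F `<=` A -> convex_hull F `<=` A.
Proof. by move=> cA FA; apply: smallest_sub => //; apply/convex_setE. Qed.

Lemma sub_convex_hull (R : realType) (F : set R[i]) : F `<=` convex_hull F.
Proof. exact: sub_gen_smallest. Qed.

Lemma convex_hull_segpt (R : realType) (F : set R[i]) (a b : R[i]) (k : R) :
  convex_hull F a -> convex_hull F b -> 0 < k < 1 ->
  convex_hull F (segpt k a b).
Proof.
move=> Fa Fb k01 A [cA FA]; move/convex_setE: (cA) => H.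
by apply: H => //; [apply: Fa|apply: Fb].
Qed.

(** A convex set stays convex when an extreme point is removed; an extreme point outside [F] would
    thus contradict the minimality of the hull. *)
Lemma vertices_hull_sub (R : realType) (F : set R[i]) :
  vertices (convex_hull F) `<=` F.
Proof.
move=> x [hx ex]; apply: contrapT => Fx.
have : (convex_hull F `&` ~` [set x]) x.
  apply: (@convex_hull_ind _ F) hx => [a b k [Fa ax] [Fb bx] k01|y Fy].
    split; first exact: convex_hull_segpt.
    by move=> /= /esym e; have [] := ex a b k Fa Fb k01 e.
  by split; [exact: sub_convex_hull|move=> /= yx; apply: Fx; rewrite -yx].
by case=> _; apply.
Qed.

(** The affine functional [f] attains its maximum over the hull at [x] only, so [x] is exposed and
    hence extreme. *)
Lemma vertices_hull (R : realType) (F : set R[i]) :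
  (forall x, F x -> exists f : R[i] -> R,
     (forall k a b, f (segpt k a b) = k * f a + (1 - k) * f b) /\
     forall y, F y -> y <> x -> f y < f x) ->
  vertices (convex_hull F) = F.
Proof.
move=> H; apply/seteqP; split; first exact: vertices_hull_sub.
move=> x Fx; split; first exact: sub_convex_hull.
have [f [fl fx]] := H x Fx.
have hF y : convex_hull F y -> y = x \/ f y < f x.
  move: y; apply: convex_hull_ind => [a b k Ha Hb /andP[k0 k1]|y Fy].
    have [ea|na] := eqVneq a x; last first.
      right; rewrite fl.
      have fa : f a < f x by case: Ha => // /eqP; rewrite (negbTE na).
      have fb : f b <= f x by case: Hb => [->//|/ltW].
      have -> : f x = k * f x + (1 - k) * f x by ring.
      by apply: ltr_leD; rewrite ?ltr_pM2l ?ler_wpM2l // subr_ge0 ltW.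
    have [eb|nb] := eqVneq b x.
      by left; rewrite ea eb -mulrDl -rmorphD /= subrKC mul1r.
    right; rewrite fl.
    have fb : f b < f x by case: Hb => // /eqP; rewrite (negbTE nb).
    have -> : f x = k * f x + (1 - k) * f x by ring.
    by rewrite ea ltrD2l ltr_pM2l // subr_gt0.
  by have [->|/eqP yx] := eqVneq y x; [left|right; apply: fx].
move=> a b k Fa Fb /andP[k0 k1] ex.
have efx : f x = k * f a + (1 - k) * f b by rewrite -fl -ex.
have pos u v : u > 0 -> v < f x -> 0 < u * (f x - v).
  by move=> u0 v0; rewrite mulr_gt0 ?subr_gt0.
have k1' : 0 < 1 - k by rewrite subr_gt0.
case: (hF a Fa) (hF b Fb) => [ea|fa] [eb|fb]; first by [].
- by exfalso; move: efx (pos _ _ k1' fb); rewrite ea; lra.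
- by exfalso; move: efx (pos _ _ k0 fa); rewrite eb; lra.
- by exfalso; move: efx (pos _ _ k0 fa) (pos _ _ k1' fb); lra.
Qed.

Lemma vertices_image (R : realType) (g : R[i] -> R[i]) (P : set R[i]) :
  segment_morph g -> injective g -> vertices (g @` P) = g @` vertices P.
Proof.
move=> gs gi; apply/seteqP; split => [y [[x Px <-] ex]|_ [x [Px ex] <-]].
  exists x => //; split=> // a b k Pa Pb k01 e.
  have e' : g x = segpt k (g a) (g b) by rewrite -gs -e.
  have [] := ex _ _ _ (ex_intro2 _ _ a Pa erefl) (ex_intro2 _ _ b Pb erefl) k01 e'.
  by move=> /gi -> /gi.
split; first by exists x.
move=> _ _ k [a Pa <-] [b Pb <-] k01; rewrite -gs => /gi e.
by have [-> ->] := ex a b k Pa Pb k01 e.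
Qed.

Lemma convex_hull_image (R : realType) (g : R[i] -> R[i]) (F : set R[i]) :
  segment_morph g -> g @` convex_hull F = convex_hull (g @` F).
Proof.
move=> gs; apply/seteqP; split => [_ [x hx <-]|].
  have : (g @^-1` convex_hull (g @` F)) x.
    move: x hx; apply: convex_hull_ind => [a b k /= ha hb k01|x Fx /=].
      by rewrite gs; apply: convex_hull_segpt.
    by apply: sub_convex_hull; exists x.
  by [].
apply: convex_hull_ind => [_ _ k [a ha <-] [b hb <-] k01|_ [x Fx <-]].
  by rewrite -gs; exists (segpt k a b) => //; apply: convex_hull_segpt.
by exists x => //; apply: sub_convex_hull.
Qed.

Lemma affine_map_diff (R : realType) (A : 'M[R]_2) (t x y z w : R[i]) (r : R) :
  x - y = r%:C%C * (z - w) ->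
  affine_map A t x - affine_map A t y =
  r%:C%C * (affine_map A t z - affine_map A t w).
Proof.
move: x y z w => [x1 x2] [y1 y2] [z1 z2] [w1 w2] /eqP.
rewrite eq_complex /= => /andP[/eqP e1 /eqP e2].
apply/eqP; rewrite eq_complex /affine_map; case: t => t1 t2 /=.
have d1 : x1 = y1 + r * (z1 - w1) by lra.
have d2 : x2 = y2 + r * (z2 - w2) by lra.
by rewrite d1 d2; apply/andP; split; apply/eqP; ring.
Qed.

Lemma affine_map_segment_morph (R : realType) (A : 'M[R]_2) (t : R[i]) :
  segment_morph (affine_map A t).
Proof.
move=> k [a1 a2] [b1 b2]; apply/eqP; rewrite eq_complex /affine_map.
by case: t => t1 t2 /=; apply/andP; split; apply/eqP; ring.
Qed.

Lemma unitmx2 (F : fieldType) (A : 'M[F]_2) :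
  (A \in unitmx) = (A 0 0 * A 1 1 - A 0 1 * A 1 0 != 0).
Proof.
rewrite unitmxE unitfE (expand_det_row A 0) !big_ord_recl big_ord0 addr0.
rewrite /cofactor !det_mx11 !mxE /= expr0 expr1 mul1r mulN1r mulrN.
by congr (A _ _ * A _ _ - A _ _ * A _ _ != 0); apply: val_inj.
Qed.

Lemma affine_map_inj (R : realType) (A : 'M[R]_2) (t : R[i]) :
  A \in unitmx -> injective (affine_map A t).
Proof.
rewrite unitmx2 => D0 [a1 a2] [b1 b2] /addIr /eqP.
rewrite eq_complex /= => /andP[/eqP e1 /eqP e2].
suff [-> ->] : a1 = b1 /\ a2 = b2 by [].
split; apply: (mulfI D0).
  transitivity (A 1 1 * (A 0 0 * a1 + A 0 1 * a2)
    - A 0 1 * (A 1 0 * a1 + A 1 1 * a2)); first by ring.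
  by rewrite e1 e2; ring.
transitivity (A 0 0 * (A 1 0 * a1 + A 1 1 * a2)
    - A 1 0 * (A 0 0 * a1 + A 0 1 * a2)); first by ring.
by rewrite e1 e2; ring.
Qed.

(** Real-valued and polynomial in the coordinates, unlike [Normc.normc], which takes a square
    root. *)
Definition sqn (R : realType) (z : R[i]) : R := Re z ^+ 2 + Im z ^+ 2.

Lemma sqnM (R : realType) (x y : R[i]) : sqn (x * y) = sqn x * sqn y.
Proof. by case: x y => [a b] [c d]; rewrite /sqn /=; ring. Qed.

Lemma sqn_gt0 (R : realType) (x : R[i]) : x != 0 -> 0 < sqn x.
Proof.
case: x => a b; rewrite eq_complex /sqn /= => h.
rewrite lt_neqAle addr_ge0 ?sqr_ge0 // andbT eq_sym paddr_eq0 ?sqr_ge0 //.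
by rewrite !sqrf_eq0.
Qed.

Lemma normc_sqn (R : realType) (x : R[i]) : Normc.normc x = Num.sqrt (sqn x).
Proof. by case: x. Qed.

Lemma sqn_prim_root (R : realType) (k : nat) (w : R[i]) :
  k.-primitive_root w -> sqn w = 1.
Proof.
move=> pw; have k0 := prim_order_gt0 pw.
have w1 : `|w| = 1.
  apply/eqP; rewrite -(@pexpr_eq1 _ _ k) // -normrX (prim_expr_order pw).
  by rewrite normr1.
by apply: (@complexI R); rewrite /sqn add_Re2_Im2 w1 expr1n.
Qed.

Lemma sqnX_prim_root (R : realType) (k j : nat) (w : R[i]) :
  k.-primitive_root w -> sqn (w ^+ j) = 1.
Proof.
move=> /sqn_prim_root w1; elim: j => [|j IH]; last by rewrite exprS sqnM w1 IH mulr1.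
by rewrite /sqn /= expr1n expr0n addr0.
Qed.

Lemma conjc_prim_root (R : realType) (k : nat) (w : R[i]) :
  k.-primitive_root w -> conjc w = w^-1.
Proof.
move=> /sqn_prim_root; case: w => a b; rewrite /sqn /= => e.
by apply/eqP; rewrite eq_complex /= e !divr1 !eqxx.
Qed.

(** The scalar product with x - c peaks strictly at [x]: for points of one circle, |y - x|^2 > 0
    amounts to <x - c, y - c> < |x - c|^2. *)
Lemma vertices_cocircular (R : realType) (F : set R[i]) (c : R[i]) (r : R) :
  (forall x, F x -> sqn (x - c) = r) -> vertices (convex_hull F) = F.
Proof.
move=> H; apply: vertices_hull => -[x1 x2] Fx; have ex := H _ Fx.
case: c H ex => c1 c2 H ex.
exists (fun z => (x1 - c1) * (Re z - c1) + (x2 - c2) * (Im z - c2)).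
split=> [k [a1 a2] [b1 b2]|[y1 y2] Fy yx] /=; first by ring.
have ey := H _ Fy.
have : 0 < sqn (Complex y1 y2 - Complex x1 x2).
  by apply: sqn_gt0; rewrite subr_eq0; apply/eqP.
move: ex ey; rewrite /sqn /= => ex ey; lra.
Qed.

(** * Regular polygons *)

Lemma val_iter_ordS (k j : nat) (i : 'I_k) :
  iter j (@ordS k) i = ((i + j) %% k)%N :> nat.
Proof.
elim: j => [|j IH]; first by rewrite addn0 modn_small.
by rewrite iterS /= IH -addn1 modnDml addn1 addnS.
Qed.

Lemma iter_ordS_neq (k j : nat) (i : 'I_k) :
  (0 < j < k)%N -> iter j (@ordS k) i != i.
Proof.
move=> /andP[j0 jk]; apply/eqP => /(congr1 val) /=.
rewrite val_iter_ordS -{2}(modn_small (ltn_ord i)) -{2}[val i]addn0 => /eqP.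
by rewrite eqn_modDl mod0n modn_small // gtn_eqF.
Qed.

(** A repeated vertex makes a positive cross product vanish. If the two indices are neighbours, the
    side between them is zero and a third vertex gives the contradiction. *)
Lemma ccw_convex_inj (R : realType) (k : nat) (v : 'I_k -> R[i]) :
  ccw_convex v -> injective v.
Proof.
move=> [k3 H] i j vij; apply/eqP; apply: contraT => nij.
have cross0 (a : R[i]) : cross a 0 = 0 by case: a => a b; rewrite /cross /=; ring.
have crossl0 (a : R[i]) : cross 0 a = 0 by case: a => a b; rewrite /cross /=; ring.
have [jS|jS] := eqVneq j (ordS i); last first.
  by have := H i j; rewrite eq_sym => /(_ nij jS); rewrite vij subrr cross0 ltxx.
have SSi : ordS j != i by rewrite jS; exact: (@iter_ordS_neq k 2).
have SSj : ordS j != ordS i by rewrite -jS; apply: (@iter_ordS_neq k 1); lia.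
by have := H i (ordS j) SSi SSj; rewrite -jS vij subrr crossl0 ltxx.
Qed.

(** By Cauchy-Schwarz the quotient lies in [-1, 1], where [cos] inverts [acos]. *)
Lemma cos_angle (R : realType) (a b : R[i]) : a != 0 -> b != 0 ->
  cos (angle a b) = (Re a * Re b + Im a * Im b) /
        (Normc.normc a * Normc.normc b).
Proof.
move=> a0 b0; rewrite /angle acosK //.
have N0 : 0 < Normc.normc a * Normc.normc b.
  by rewrite !normc_sqn mulr_gt0 // sqrtr_gt0 sqn_gt0.
rewrite in_itv /= -ler_norml normrM normfV (gtr0_norm N0) ler_pdivrMr // mul1r.
have sq : (Re a * Re b + Im a * Im b) ^+ 2 <= (Normc.normc a * Normc.normc b) ^+ 2.
  rewrite exprMn !normc_sqn !sqr_sqrtr ?(ltW (sqn_gt0 _)) //.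
  case: a b {a0 b0 N0} => [a1 a2] [b1 b2]; rewrite /sqn /=.
  have := sqr_ge0 (a1 * b2 - a2 * b1); nra.
by rewrite -ler_sqrt ?sqr_ge0 // !sqrtr_sqr (gtr0_norm N0) in sq.
Qed.

(** Equal sides and angles make the scalar product of consecutive sides constant, hence also the
    square of their cross product; the orientation fixes its sign. So consecutive sides have a
    constant complex ratio [w]. Closing up gives w^k = 1, and injectivity of [v] makes [w]
    primitive. *)
Lemma regular_polygon_vertices (R : realType) (Q : set R[i]) :
  regular_polygon Q -> exists (k : nat) (w a b : R[i]),
    [/\ (3 <= k)%N, k.-primitive_root w, b != 0 &
        Q = convex_hull (range (fun i : 'I_k => a + b * w ^+ i))].
Proof.
move=> [k [v [ccw eQ sides angles]]].
have vinj := ccw_convex_inj ccw; case: (ccw) => k3 cr.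
pose e i := v (ordS i) - v i.
have Sneq (i : 'I_k) : ordS i != i.
  by apply: (@iter_ordS_neq k 1 i); lia.
have SSneq (i : 'I_k) : ordS (ordS i) != i by exact: (@iter_ordS_neq k 2 i).
have e0 i : e i != 0 by rewrite subr_eq0; apply: contra (Sneq i) => /eqP/vinj ->.
have crS i : 0 < cross (e i) (e (ordS i)).
  have := cr i (ordS (ordS i)) (SSneq _) (Sneq _).
  rewrite /cross /e; case: (v _) (v _) (v _) => [a1 a2] [b1 b2] [c1 c2] /=; nra.
pose i0 : 'I_k := Ordinal (leq_trans (isT : (0 < 3)%N) k3).
pose L := sqn (e i0).
have L0 : 0 < L by apply: sqn_gt0.
have eL i : sqn (e i) = L.
  have := sides i i0; rewrite !normc_sqn => /(congr1 (fun x => x ^+ 2)).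
  by rewrite !sqr_sqrtr ?ltW ?sqn_gt0 // e0.
pose dot (x y : R[i]) := Re x * Re y + Im x * Im y.
have eD i : dot (e i) (e (ordS i)) = dot (e i0) (e (ordS i0)).
  have := angles i i0; move=> /(congr1 (@cos R)).
  have nS j : v j - v (ordS j) != 0 by rewrite -opprB oppr_eq0 e0.
  rewrite !cos_angle ?e0 ?nS //.
  have eN j : v j - v (ordS j) = - e j by rewrite opprB.
  rewrite !eN -!/(e _) !normc_sqn.
  have sN z : sqn (- z) = sqn z by case: z => z1 z2; rewrite /sqn /= !sqrrN.
  have sL0 : Num.sqrt L != 0 by rewrite gt_eqF // sqrtr_gt0.
  rewrite !sN !eL => /(mulIf (invr_neq0 (mulf_neq0 sL0 sL0))).
  rewrite /dot; case: (e i) (e (ordS i)) (e i0) (e (ordS i0)).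
  move=> x1 x2 [y1 y2] [z1 z2] [t1 t2] /=; lra.
have LDC (x y : R[i]) : cross x y ^+ 2 = sqn x * sqn y - dot x y ^+ 2.
  by case: x y => [x1 x2] [y1 y2]; rewrite /cross /sqn /dot /=; ring.
have eC i : cross (e i) (e (ordS i)) = cross (e i0) (e (ordS i0)).
  apply/eqP; rewrite -(@eqrXn2 _ 2) ?ltW ?crS //.
  by rewrite !LDC !eL !eD.
(* This is the quotient of the first two sides, conj(e_0) e_1 / |e_0|^2. *)
pose w := Complex (dot (e i0) (e (ordS i0)) / L) (cross (e i0) (e (ordS i0)) / L).
have ew i : e (ordS i) = w * e i.
  have LI : L != 0 by rewrite gt_eqF.
  have := eD i; have := eC i; have := eL i; rewrite /w /cross /dot /sqn.
  case: (e i) (e (ordS i)) => [x1 x2] [y1 y2] /= hL hC hD.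
  rewrite -hC -hD; apply/eqP; rewrite eq_complex /=.
  apply/andP; split; apply/eqP; apply: (mulfI LI); rewrite -hL; rewrite -hL in LI; field.
    by rewrite hL gt_eqF.
  by rewrite hL gt_eqF.
have w1 : w - 1 != 0.
  by rewrite eq_complex /= negb_and oppr0 addr0 orbC (gt_eqF (divr_gt0 (crS _) L0)).
(* The sides form a geometric progression, whose partial sums are b (w^j - 1). *)
pose b := e i0 / (w - 1); pose a := v i0 - b.
pose u j := v (iter j (@ordS k) i0).
have eu j : e (iter j (@ordS k) i0) = w ^+ j * e i0.
  by elim: j => [|j IH]; rewrite ?mul1r // iterS ew IH exprS mulrA.
have uE j : u j = a + b * w ^+ j.
  elim: j => [|j IH]; first by rewrite expr0 mulr1 subrK.
  have -> : u j.+1 = u j + e (iter j (@ordS k) i0) by rewrite /u /e iterS; ring.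
  rewrite IH eu exprS /b -addrA; congr (_ + _).
  by field.
have vE i : v i = a + b * w ^+ i.
  rewrite -uE; congr v; apply: val_inj.
  by rewrite [RHS]val_iter_ordS add0n modn_small.
have b0 : b != 0 by rewrite mulf_neq0 ?invr_eq0.
have wk : w ^+ k = 1.
  have : u k = u 0.
    congr v; apply: val_inj; rewrite [LHS]val_iter_ordS.
    by rewrite [RHS]val_iter_ordS addn0 add0n modnn mod0n.
  by rewrite !uE => /addrI /(mulfI b0).
have [m pm mk] := prim_order_exists (leq_trans (isT : (0 < 3)%N) k3) wk.
have mk' : m = k.
  have m0 := prim_order_gt0 pm.
  have : (m <= k)%N by rewrite dvdn_leq //; lia.
  rewrite leq_eqVlt => /orP[/eqP //|lmk].
  have : v (Ordinal lmk) = v i0 by rewrite !vE /= (prim_expr_order pm).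
  by move=> /vinj /(congr1 val) /=; lia.
have pk : k.-primitive_root w by rewrite -mk'.
exists k, w, a, b; split => //.
by rewrite eQ (_ : v = fun i : 'I_k => a + b * w ^+ i) //; apply/funext.
Qed.

Lemma card_range_ord (T : Type) (k : nat) (f : 'I_k -> T) :
  injective f -> (range f #= `I_k)%card.
Proof.
move=> fi; rewrite (card_eql (inj_card_eq _)); first last.
  by move=> x y _ _; exact: fi.
by rewrite card_eq_sym card_II.
Qed.

Lemma prim_root_exp_inj (F : fieldType) (k : nat) (w : F) :
  k.-primitive_root w -> injective (fun i : 'I_k => w ^+ i).
Proof.
move=> pw i j /eqP; rewrite (eq_prim_root_expr pw) !modn_small // => /eqP.
exact: val_inj.
Qed.

(** In the regular polygon the chord is parallel to the side, with real ratio 1 + w + 1/w, and an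
    affine map keeps this ratio; the relation is multiplied by [w] to avoid the inverse. For m = 3
    the points [p0] and [p3] coincide and both sides vanish. *)
Lemma gon_chord_relation (R : realType) (m : nat) (L : set R[i]) :
  has_affinely_regular_gon m L ->
  exists w p0 p1 p2 p3 : R[i],
    [/\ (3 <= m)%N, m.-primitive_root w, [/\ L p0, L p1, L p2 & L p3],
        p2 - p1 != 0 & w * (p3 - p0) = (1 + w + w ^+ 2) * (p2 - p1)].
Proof.
move=> [P [[[Q [A [t [rQ Au eP]]]] cP] [_ vL]]].
have [k [w [a [b [k3 pw b0 eQ]]]]] := regular_polygon_vertices rQ.
set f := (fun i : 'I_k => a + b * w ^+ i) in eQ.
pose g := affine_map A t.
have gi : injective g := affine_map_inj Au.
have fi : injective f by move=> i j /addrI /(mulfI b0) /(prim_root_exp_inj pw).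
have vP : vertices P = range (g \o f).
  rewrite eP vertices_image //; last exact: affine_map_segment_morph.
  rewrite eQ (vertices_cocircular (c := a) (r := sqn b)) ?image_comp //.
  move=> _ [i _ <-]; rewrite /f addrC addKr sqnM.
  by rewrite (sqnX_prim_root _ pw) mulr1.
have emk : m = k.
  apply/card_eq_II; apply: (@card_eq_trans _ _ _ _ (vertices P)).
    by rewrite card_eq_sym.
  by rewrite vP; apply: card_range_ord => i j /gi /fi.
subst m; pose p j := g (a + b * w ^+ j).
have Lp j : L (p j).
  apply: vL; rewrite vP; have k0 : (0 < k)%N by lia.
  exists (Ordinal (ltn_pmod j k0)) => //.
  by rewrite /p /= /f /= (prim_expr_mod pw).
exists w, (p 0%N), (p 1%N), (p 2%N), (p 3%N); split => //.
  rewrite subr_eq0; apply/eqP => /gi /addrI /(mulfI b0) /eqP.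
  by rewrite (eq_prim_root_expr pw) !modn_small ?(ltnW k3).
have w0 := prim_root_neq0 pw.
pose r := 1 + 2 * Re w.
have er : r%:C%C * w = 1 + w + w ^+ 2.
  apply: (mulIf (invr_neq0 w0)); rewrite mulfK //.
  have -> : r%:C%C = 1 + (w + conjc w).
    by rewrite addcJ /r rmorphD rmorphM /= rmorph1 rmorph_nat.
  rewrite (conjc_prim_root pw); field.
  exact: w0.
have -> : p 3 - p 0 = r%:C%C * (p 2 - p 1); last by rewrite -er; ring.
apply: affine_map_diff; apply: (mulfI w0).
transitivity (r%:C%C * w * (b * w * (w - 1))); last by ring.
by rewrite er; ring.
Qed.

(** * Cyclotomic rings and fields *)

Lemma zetaX (R : realType) (n j : nat) :
  zeta n ^+ j = Complex (cos (j%:R * (2 * pi / n%:R)))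
                        (sin (j%:R * (2 * pi / n%:R))) :> R[i].
Proof.
elim: j => [|j IH]; first by rewrite expr0 mul0r cos0 sin0.
set a : R := 2 * pi / n%:R in IH *.
have -> : j.+1%:R * a = a + j%:R * a by rewrite -natr1; ring.
apply/eqP; rewrite exprS IH /zeta -/a eq_complex cosD sinD /=; apply/andP; split; apply/eqP; ring.
Qed.

Lemma sin_pi_frac_gt0 (R : realType) (n j : nat) :
  (0 < j < n)%N -> 0 < sin (j%:R * (pi / n%:R) : R).
Proof.
move=> /andP[j0 jn]; have n0 : (0 < n)%N by lia.
have pi0 := pi_gt0 R; have nR : 0 < n%:R :> R by rewrite ltr0n.
apply: sin_gt0_pi; rewrite mulr_gt0 ?divr_gt0 ?ltr0n //=.
by rewrite mulrA ltr_pdivrMr // mulrC ltr_pM2l // ltr_nat.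
Qed.

(** An order k < n would give cos(2 k pi / n) = 1, hence sin(k pi / n) = 0, although k pi / n lies
    strictly between 0 and pi. *)
Lemma zeta_prim (R : realType) (n : nat) :
  (0 < n)%N -> n.-primitive_root (zeta n : R[i]).
Proof.
move=> n0; have z1 : zeta n ^+ n = 1 :> R[i].
  have nR : n%:R != 0 :> R by rewrite pnatr_eq0; lia.
  rewrite zetaX mulrC divfK // mulr_natl cos2pi sin2pi.
  by [].
have [k pk kn] := prim_order_exists n0 z1.
have k0 := prim_order_gt0 pk.
have : (k <= n)%N by rewrite dvdn_leq.
rewrite leq_eqVlt => /orP[/eqP kn'|ltkn]; first by rewrite -{1}kn'.
have kb : (0 < k < n)%N by rewrite k0.
move: (prim_expr_order pk); rewrite zetaX => -[].
have -> : k%:R * (2 * pi / n%:R) = (k%:R * (pi / n%:R)) *+ 2 :> R.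
  by rewrite -mulr_natl; ring.
rewrite cos_mulr2n cos2sin2 => e _; exfalso.
have := exprn_gt0 2 (sin_pi_frac_gt0 R kb).
move: e; rewrite -mulr_natl => e; lra.
Qed.

(** In polynomial form, the image of an element under an automorphism is determined by the image of
    [zeta n]. *)
Lemma cyclotomic_ringP (R : realType) (n : nat) (z : R[i]) :
  cyclotomic_ring n z <-> exists p : {poly int}, z = (map_poly intr p).[zeta n].
Proof.
split=> [|[p ->]]; last first.
  move=> S [cS zS].
  have Szeta : S (zeta n) by exact: zS.
  have [S1 SB SM] := cS.
  have S0 : 0 \in mem S by rewrite -(subrr 1) SB.
  have SD (x y : R[i]) : x \in mem S -> y \in mem S -> x + y \in mem S.
    by move=> xS yS; rewrite -[y]opprK SB // -[- y]sub0r SB.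
  have SN (i : nat) : (i%:R : R[i]) \in mem S.
    by elim: i => [//|i IH]; rewrite -addn1 natrD SD.
  have SZ (i : int) : (i%:~R : R[i]) \in mem S.
    case: i => i; first by rewrite SN.
    by rewrite NegzE mulrNz -[- _]sub0r SB // SN.
  suff : (map_poly intr p).[zeta n] \in mem S by rewrite inE.
  elim/poly_ind: p => [|p c IH]; first by rewrite rmorph0 horner0.
  rewrite rmorphD rmorphM /= map_polyX map_polyC !hornerE.
  by apply: SD; [apply: SM; rewrite // inE|exact: SZ].
suff : cyclotomic_ring n `<=`
    [set z : R[i] | exists p : {poly int}, z = (map_poly intr p).[zeta n]] by apply.
apply: smallest_sub; last first.
  by move=> _ ->; exists 'X; rewrite map_polyX hornerX.
split=> [|x y|x y]; rewrite !inE /=.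
- by exists 1; rewrite rmorph1 hornerC.
- by move=> [p ->] [q ->]; exists (p - q); rewrite rmorphB !hornerE.
- by move=> [p ->] [q ->]; exists (p * q); rewrite rmorphM !hornerE.
Qed.

Lemma cyclotomic_ring_closed (R : realType) (n : nat) :
  GRing.subring_closed (mem (@cyclotomic_ring R n)).
Proof.
split=> [|x y|x y]; rewrite !inE.
- by move=> S [[S1 SB SM] zS]; move: S1; rewrite inE.
- move=> xS yS S cS; have [[S1 SB SM] zS] := cS.
  by have := SB x y; rewrite !inE; apply; [exact: xS|exact: yS].
- move=> xS yS S cS; have [[S1 SB SM] zS] := cS.
  by have := SM x y; rewrite !inE; apply; [exact: xS|exact: yS].
Qed.

Lemma cyclotomic_field_closed (R : realType) (n : nat) :
  GRing.divring_closed (mem (@cyclotomic_field R n)).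
Proof.
split=> [|x y|x y]; rewrite !inE.
- by move=> S [[S1 SB SM] zS]; move: S1; rewrite inE.
- move=> xS yS S cS; have [[S1 SB SM] zS] := cS.
  by have := SB x y; rewrite !inE; apply; [exact: xS|exact: yS].
- move=> xS yS S cS; have [[S1 SB SM] zS] := cS.
  by have := SM x y; rewrite !inE; apply; [exact: xS|exact: yS].
Qed.

(** The translation [t] cancels in the chords, which are therefore integer polynomials in
    [zeta n]. *)
Lemma model_set_gon_order (R : realType) (m n : nat) (L : set R[i]) :
  (0 < n)%N -> cyclotomic_model_set n L -> has_affinely_regular_gon m L ->
  [\/ m \in [:: 3; 4; 6]%N, (m %| n)%N
    | exists2 d, odd d && (d %| n)%N & m = (2 * d)%N].
Proof.
move=> n0 [s [t [W [_ _ eL]]]] /gon_chord_relation.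
move=> [w [p0 [p1 [p2 [p3 [m3 pw [Lp0 Lp1 Lp2 Lp3] p12 e]]]]]].
have [_ OB _] := @cyclotomic_ring_closed R n.
have diffO x y : L x -> L y -> cyclotomic_ring n (x - y).
  rewrite eL => -[z1 [z1O _] <-] [z2 [z2O _] <-].
  rewrite opprD addrACA subrr add0r.
  by have := OB z1 z2; rewrite !inE; apply.
have /cyclotomic_ringP[q eq] := diffO _ _ Lp2 Lp1.
have /cyclotomic_ringP[p ep] := diffO _ _ Lp3 Lp0.
rewrite eq ep in p12 e.
have mn0 : (0 < m * n)%N by rewrite muln_gt0 n0 andbT; lia.
exact: (cos_quotient_order m3 (zeta_prim R mn0) pw (zeta_prim R n0) p12 (esym e)).
Qed.

(** * Small conjugates and density *)

Lemma sum_root_unity (F : fieldType) (n : nat) (y : F) :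
  y ^+ n = 1 -> \sum_(i < n) y ^+ i = if y == 1 then n%:R else 0.
Proof.
move=> yn; case: eqP => [->|/eqP y1].
  by rewrite (eq_bigr (fun=> 1)) ?sumr_const ?card_ord // => i _; rewrite expr1n.
have := subrX1 y n; rewrite yn subrr => /esym /eqP.
by rewrite mulf_eq0 subr_eq0 (negbTE y1) => /eqP.
Qed.

(* The coefficients are those of the inverse discrete Fourier transform of the
   conjugation-symmetric extension of [w] by [0] to all n-th roots of unity. *)
Lemma root_unity_interpolation (R : realType) (n k : nat) (z w : 'I_k -> R[i]) :
  (forall j, n.-primitive_root (z j)) ->
  (forall j l, j != l -> z j != z l) -> (forall j l, z j * z l != 1) ->
  exists r : 'I_n -> R,
    forall j, \sum_(i < n) (r i)%:C%C * z j ^+ i = w j.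
Proof.
move=> pz zneq zneqV.
have [n0|n0] := posnP n.
  by exists (fun=> 0) => j; have := prim_order_gt0 (pz j); rewrite n0.
have nR : n%:R != 0 :> R[i] by rewrite pnatr_eq0; lia.
exists (fun i => 2 * Re (n%:R^-1 * \sum_j w j * z j ^- i)) => l.
have zn j : z j ^+ n = 1 by exact: prim_expr_order.
(* Twice the real part adds the conjugate term, in which 1 / z_j becomes z_j. Of all these geometric
   sums only the one with ratio z_l / z_l is nonzero. *)
transitivity (n%:R^-1 * \sum_j (w j * (\sum_(i < n) (z l / z j) ^+ i)
                   + conjc (w j) * (\sum_(i < n) (z l * z j) ^+ i))).
  transitivity (\sum_(i < n) n%:R^-1 * \sum_j (w j * (z l / z j) ^+ i
      + conjc (w j) * (z l * z j) ^+ i)).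
    apply: eq_bigr => i _.
    have -> (x : R[i]) : (2 * Re x)%:C%C = x + conjc x.
      by rewrite addcJ rmorphM rmorph_nat.
    rewrite rmorphM rmorph_sum /= conjc_inv conjc_nat -mulrDr -big_split /=.
    rewrite -mulrA mulr_suml; congr (_ * _); apply: eq_bigr => j _.
    rewrite rmorphM /= conjc_inv rmorphXn /= (conjc_prim_root (pz j)).
    by rewrite !exprMn !exprVn invrK; ring.
  rewrite -mulr_sumr exchange_big /=; congr (_ * _); apply: eq_bigr => j _.
  by rewrite big_split /= !mulr_sumr.
have z0 j : z j != 0 := prim_root_neq0 (pz j).
rewrite (bigD1 l) //= [X in _ * (_ + X)]big1 => [|j jl].
  rewrite !sum_root_unity ?exprMn ?exprVn ?zn ?invr1 ?mulr1 //.
  rewrite (negbTE (zneqV l l)) divff ?eqxx //.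
  by rewrite mulr0 !addr0 mulrCA mulVf // mulr1.
rewrite !sum_root_unity ?exprMn ?exprVn ?zn ?invr1 ?mulr1 //.
rewrite (negbTE (zneqV _ _)) (_ : (z l / z j == 1) = false) ?mulr0 ?addr0 //.
apply/negbTE/eqP => /(canRL (divfK (z0 j))); rewrite mul1r => /eqP.
by rewrite eq_sym (negbTE (zneq _ _ jl)).
Qed.

(* Dirichlet's box principle: [N ^ (k + 1)] coefficient vectors are sorted into
   at most [q ^ k] boxes of side [eps], with [N = s ^ k] and
   [q = s ^ (k + 1) - 1], so that [q ^ k < N ^ (k + 1)]. *)
Lemma small_int_poly (R : realType) (k : nat) (x : 'I_k -> R) (eps : R) :
  0 < eps -> (forall i, 0 <= x i) ->
  exists p : {poly int}, [/\ p != 0, (size p <= k.+1)%N &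
    forall i, `|(map_poly intr p).[x i]| < eps].
Proof.
move=> eps0 x0.
(* For k = 0 the box count would read 1 < 1, but then there is no smallness condition to meet. *)
have [k0|k0] := posnP k.
  exists 1; rewrite oner_neq0 size_poly1; split=> // i.
  by have := ltn_ord i; rewrite {2}k0.
pose C := 1 + \sum_i \sum_(j < k.+1) x i ^+ j.
have C0 : 0 <= C.
  by apply: addr_ge0 => //; do 2![apply: sumr_ge0 => ? _]; exact: exprn_ge0.
have CE i : \sum_(j < k.+1) x i ^+ j < C.
  rewrite /C (bigD1 i) //= addrCA ltrDl ltr_pwDl //.
  by do 2![apply: sumr_ge0 => ? _]; exact: exprn_ge0.
(* The margin of 1 in [sC], multiplied by N >= 1, pays for the -1 in [q]. *)
pose s := (Num.bound (C / eps)).+2.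
have sC : C / eps + 1 <= s%:R.
  have := archi_boundP (divr_ge0 C0 (ltW eps0)).
  by rewrite /s -addn1 -addn1 !natrD => ?; lra.
pose N := (s ^ k)%N; pose q := (s ^ k.+1).-1.
have N0 : (0 < N)%N by rewrite expn_gt0.
have boxes : (q ^ k < N ^ k.+1)%N.
  rewrite /N -expnM mulnC expnM ltn_exp2r // /q.
  by rewrite ltn_predL expn_gt0.
have NC : N%:R * C / eps <= q%:R.
  have -> : q%:R = s%:R * N%:R - 1 :> R.
    by rewrite /q -subn1 natrB ?expn_gt0 // expnS natrM.
  have N1 : 1 <= N%:R :> R by rewrite ler1n.
  have N0R : 0 <= N%:R :> R by rewrite ler0n.
  rewrite -mulrA; have := ler_wpM2l N0R sC; lra.
pose v (c : {ffun 'I_k.+1 -> 'I_N}) i := \sum_(j < k.+1) (c j)%:R * x i ^+ j.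
have v0 c i : 0 <= v c i.
  by apply: sumr_ge0 => j _; rewrite mulr_ge0 ?ler0n ?exprn_ge0.
have vq c i : (Num.truncn (v c i / eps) < q)%N.
  have /andP[tv _] := truncn_itv (divr_ge0 (v0 c i) (ltW eps0)).
  rewrite -(ltr_nat R); apply: le_lt_trans tv _; apply: lt_le_trans _ NC.
  rewrite ltr_pM2r ?invr_gt0 //.
  apply: (@le_lt_trans _ _ (\sum_(j < k.+1) N%:R * x i ^+ j)).
    apply: ler_sum => j _; rewrite ler_wpM2r ?exprn_ge0 // ler_nat.
    exact: ltnW (ltn_ord _).
  by rewrite -mulr_sumr ltr_pM2l // ltr0n.
pose box (c : {ffun 'I_k.+1 -> 'I_N}) := [ffun i => Ordinal (vq c i)].
have /injectivePn[c [c' cc' ebox]] : ~~ injectiveb box.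
  apply/injectiveP => /leq_card.
  by rewrite !card_ffun !card_ord leqNgt boxes.
pose d (j : nat) : int := (c (inord j))%:Z - (c' (inord j))%:Z.
exists (\poly_(j < k.+1) d j); split; last first.
- move=> i; rewrite poly_def rmorph_sum /= horner_sum.
  have -> : \sum_(j < k.+1) (map_poly intr (d j *: 'X^j)).[x i] = v c i - v c' i.
    rewrite -sumrB; apply: eq_bigr => j _.
    rewrite map_polyZ map_polyXn hornerZ hornerXn -mulrBl /d inord_val.
    by rewrite rmorphB.
  have /ffunP/(_ i) := ebox; rewrite !ffunE => /(congr1 val) /= et.
  have /andP[a1 a2] := truncn_itv (divr_ge0 (v0 c i) (ltW eps0)).
  have /andP[b1 b2] := truncn_itv (divr_ge0 (v0 c' i) (ltW eps0)).
  rewrite et -natr1 in a1 a2; rewrite -natr1 in b2.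
  rewrite -[eps]mul1r -ltr_pdivrMr // -[eps in X in X < _]gtr0_norm //.
  rewrite -normfV -normrM mulrBl ltr_norml; apply/andP; split; lra.
- exact: size_poly.
- apply: contraNneq cc' => e0; apply/eqP/ffunP => j; apply: val_inj.
  have := congr1 (fun p : {poly int} => p`_j) e0.
  rewrite coef_poly ltn_ord coef0 /d inord_val => /eqP.
  by rewrite subr_eq0 => /eqP [].
Qed.

(** * Automorphisms of the cyclotomic field *)

Lemma zeta_field (R : realType) (n : nat) : @cyclotomic_field R n (zeta n).
Proof. by move=> S [_]; apply. Qed.

Section FieldMorphism.
Context {R : realType} (n : nat).
Let K := @cyclotomic_field R n.

Let K1 : 1 \in K.
Proof. by have [] := @cyclotomic_field_closed R n. Qed.

Let KB x y : x \in K -> y \in K -> x - y \in K.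
Proof. by have [_ + _] := @cyclotomic_field_closed R n; apply. Qed.

Let KV x y : x \in K -> y \in K -> x / y \in K.
Proof. by have [_ _] := @cyclotomic_field_closed R n; apply. Qed.

Let K0 : 0 \in K.
Proof. by rewrite -(subrr 1) KB. Qed.

Let KN x : x \in K -> - x \in K.
Proof. by move=> xK; rewrite -sub0r KB. Qed.

Let KI x : x \in K -> x^-1 \in K.
Proof. by move=> xK; rewrite -div1r KV. Qed.

Let KM x y : x \in K -> y \in K -> x * y \in K.
Proof. by move=> xK yK; rewrite -[y]invrK KV ?KI. Qed.

Let KD x y : x \in K -> y \in K -> x + y \in K.
Proof. by move=> xK yK; rewrite -[y]opprK KB ?KN. Qed.

Let Kz : zeta n \in K.
Proof. by rewrite inE; exact: zeta_field. Qed.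

Lemma cyclotomic_field_morph0 (f : R[i] -> R[i]) :
  {in K &, {morph f : x y / x + y}} -> f 0 = 0.
Proof. by move=> fD; apply: (addrI (f 0)); rewrite -fD ?K0 // !addr0. Qed.

(** The equaliser of two field morphisms is a division ring containing [zeta n], so it is all of
    [K]. Membership in [K] is carried along because the morphism laws are only given there. *)
Lemma cyclotomic_field_morph_eq (f g : R[i] -> R[i]) :
  {in K &, {morph f : x y / x + y}} -> {in K &, {morph f : x y / x * y}} ->
  {in K &, {morph g : x y / x + y}} -> {in K &, {morph g : x y / x * y}} ->
  f 1 = 1 -> g 1 = 1 -> f (zeta n) = g (zeta n) -> {in K, f =1 g}.
Proof.
move=> fD fM gD gM f1 g1 fg.
suff : K `<=` [set z | z \in K /\ f z = g z].
  by move=> H z; rewrite inE => /H [].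
have fB (h : R[i] -> R[i]) : {in K &, {morph h : x y / x + y}} ->
    {in K &, {morph h : x y / x - y}}.
  move=> hD x y xK yK; apply: (addIr (h y)).
  by rewrite -hD ?KB // !subrK.
have fV (h : R[i] -> R[i]) : {in K &, {morph h : x y / x + y}} ->
    {in K &, {morph h : x y / x * y}} -> h 1 = 1 ->
    {in K &, {morph h : x y / x / y}}.
  move=> hD hM h1 x y xK yK; rewrite hM ?KI //; congr (_ * _).
  have [->|y0] := eqVneq y 0.
    by rewrite invr0 (cyclotomic_field_morph0 hD) invr0.
  have hy : h y * h y^-1 = 1 by rewrite -hM ?KI // divff.
  have hy0 : h y != 0.
    by apply/eqP => hy0; move: hy; rewrite hy0 mul0r => /esym/eqP; rewrite oner_eq0.
  by apply: (mulfI hy0); rewrite hy divff.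
apply: smallest_sub; last by move=> _ -> /=; split.
split=> [|x y|x y]; rewrite !inE /=.
- by split; rewrite ?f1 ?g1.
- move=> [xK ex] [yK ey]; split; first exact: KB.
  by rewrite (fB _ fD) // (fB _ gD) // ex ey.
- move=> [xK ex] [yK ey]; split; first exact: KV.
  by rewrite (fV _ fD fM) // (fV _ gD gM) // ex ey.
Qed.

Lemma cyclotomic_aut1 (s : R[i] -> R[i]) : cyclotomic_aut n s -> s 1 = 1.
Proof. by move=> [_ _ _ sq]; have := sq 1; rewrite rmorph1. Qed.

Lemma cyclotomic_aut_inj (s : R[i] -> R[i]) :
  cyclotomic_aut n s -> {in K &, injective s}.
Proof. by move=> [[_ si _] _ _ _]. Qed.

Lemma cyclotomic_aut_horner (s : R[i] -> R[i]) (p : {poly int}) (z : R[i]) :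
  cyclotomic_aut n s -> z \in K -> (map_poly intr p).[z] \in K /\
  s (map_poly intr p).[z] = (map_poly intr p).[s z].
Proof.
move=> cs zK; have [_ sD sM sq] := cs.
have KZ (c : int) : (c%:~R : R[i]) \in K.
  have KNat (i : nat) : (i%:R : R[i]) \in K.
    elim: i => [|i IH]; first by rewrite K0.
    by rewrite -natr1 KD.
  by case: c => c; rewrite ?NegzE ?mulrNz ?KN ?KNat.
elim/poly_ind: p => [|p c [pK IH]].
  by rewrite !rmorph0 !horner0 K0 (cyclotomic_field_morph0 sD).
rewrite !rmorphD !rmorphM /= !map_polyX !map_polyC !hornerE /=.
have pzK : (map_poly intr p).[z] * z \in K by apply: KM.
split; first by rewrite KD.
by rewrite sD // sM // IH -[in LHS](ratr_int R[i]) sq ratr_int.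
Qed.

(** Injectivity of [s] on the field prevents the order of [zeta n] from dropping. *)
Lemma cyclotomic_aut_prim (s : R[i] -> R[i]) :
  (0 < n)%N -> cyclotomic_aut n s -> n.-primitive_root (s (zeta n)).
Proof.
move=> n0 cs; have pz := zeta_prim R n0.
have sX j : zeta n ^+ j \in K /\ s (zeta n ^+ j) = s (zeta n) ^+ j.
  have := cyclotomic_aut_horner 'X^j cs Kz.
  rewrite map_polyXn !hornerXn. by [].
have sn : s (zeta n) ^+ n = 1.
  by rewrite -(sX n).2 (prim_expr_order pz) cyclotomic_aut1.
have [k pk kn] := prim_order_exists n0 sn.
have nk : (n %| k)%N.
  rewrite (prim_order_dvd pz); apply/eqP; apply: (cyclotomic_aut_inj cs).
  - exact: (sX k).1.
  - exact: K1.
  by rewrite (sX k).2 (prim_expr_order pk) cyclotomic_aut1.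
have ekn : k = n by apply/eqP; rewrite eqn_dvd kn.
by rewrite -{1}ekn.
Qed.

(** Equal images of [zeta n] mean that [s j] and [s l] agree, and inverse images mean that they are
    conjugate. Either way [j] and [l] would both represent the conjugate pair of [s l]. *)
Lemma aut_selection_separated (s : nat -> R[i] -> R[i]) (j l : nat) :
  (0 < n)%N -> aut_selection n s ->
  (1 <= j <= (totient n)./2)%N -> (1 <= l <= (totient n)./2)%N -> j != l ->
  s j (zeta n) != s l (zeta n) /\ s j (zeta n) * s l (zeta n) != 1.
Proof.
move=> n0 [cs _ uniq] ij il; have cj := cs j ij; have cl := cs l il.
have [j0 [_ uj]] := uniq _ cl.
have jl : j0 = l by apply: uj; split=> //; left.
have [_ jD jM _] := cj; have [_ lD lM _] := cl.
move=> njl; split; apply: contraNneq njl => e; apply/eqP; rewrite -jl; apply/esym/uj; split=> //.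
  left; apply: cyclotomic_field_morph_eq => //; exact: cyclotomic_aut1.
right; apply: cyclotomic_field_morph_eq => //.
- by move=> x y xK yK; rewrite lD // rmorphD.
- by move=> x y xK yK; rewrite lM // rmorphM.
- exact: cyclotomic_aut1.
- by rewrite cyclotomic_aut1 // conjc1.
rewrite (conjc_prim_root (cyclotomic_aut_prim n0 cl)).
have pl := cyclotomic_aut_prim n0 cl.
have zl0 := prim_root_neq0 pl.
by apply: (mulIf zl0); rewrite e mulVf.
Qed.

End FieldMorphism.

(** * Scaled copies of finite sets inside a model set *)

Lemma real_complex_horner (R : realType) (p : {poly int}) (x : R) :
  ((map_poly intr p).[x])%:C%C = (map_poly intr p).[x%:C%C].
Proof.
rewrite -[LHS](horner_map (real_complex R)) -map_poly_comp /=.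
by congr (_.[_]); apply: eq_map_poly => c /=; rewrite rmorph_int.
Qed.

(** The radius of a ball is a priori an element of [R[i]]; being positive, it is real. *)
Lemma rV_ballP (R : realType) (k : nat) (W : set 'rV[R[i]^o]_k) (w : 'rV[R[i]^o]_k) :
  interior W w -> exists2 e : R, 0 < e &
    forall y : 'rV[R[i]^o]_k, (forall j, `|w 0 j - y 0 j| < e%:C%C) -> W y.
Proof.
move=> /nbhs_ballP[e /= e0 eW].
have ee : e = (Re e)%:C%C by rewrite RRe_real // ger0_real // ltW.
exists (Re e) => [|y ye]; first by rewrite -ltcR -ee.
apply: eW; split=> // i j; rewrite -ball_normE /= ee ord1.
exact: ye.
Qed.

(** The shift by 2 provides the nonnegative evaluation points that [small_int_poly] asks for. *)
Lemma Re_prim_root_ge (R : realType) (n : nat) (z : R[i]) :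
  n.-primitive_root z -> 0 <= 2 + 2 * Re z.
Proof.
move=> /sqn_prim_root; rewrite /sqn => e.
have := sqr_ge0 (Im z); nra.
Qed.

(* [lam i] is the i-th conjugate of the small element [lam 1].  Writing the centre
   [w] of a ball in the window as [w j = lam j.+2 * \sum_i r_i z_j ^+ i] with real
   [r_i], rounding the [r_i] costs only a multiple of [lam j.+2]. *)
Lemma model_set_affine_copy (R : realType) (m n : nat) (L : set R[i])
    (g : 'I_m -> R[i]) :
  (3 <= n)%N -> cyclotomic_model_set n L ->
  (forall i, cyclotomic_ring n (g i)) ->
  exists (lam : R) (c : R[i]), lam != 0 /\ forall i, L (c + lam%:C%C * g i).
Proof.
move=> n3 [s [t [W [sel [[w Ww] WW _ _] eL]]]] gO.
have n0 : (0 < n)%N by lia.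
have [cs s1 _] := sel.
set h := (totient n)./2 in cs sel; pose k := h.-1.
have h0 : (0 < h)%N.
  have : (1 < totient n)%N by rewrite totient_gt1.
  by rewrite /h; lia.
have [e e0 eW] := rV_ballP Ww.
have zetaK : zeta n \in @cyclotomic_field R n by rewrite inE; exact: zeta_field.
have [G GE] := choice (fun i => (cyclotomic_ringP n (g i)).1 (gO i)).
have pz i : (1 <= i <= h)%N -> n.-primitive_root (s i (zeta n)).
  by move=> /cs; exact: cyclotomic_aut_prim.
pose X i : R := 2 + 2 * Re (s i (zeta n)).
(* At an n-th root of unity z this is 2 + z + 1/z, so each [X i] is a conjugate of one real element
   of O_n. *)
pose q : {poly int} := 'X + 'X^(n.-1) + 2%:P.
have zVn (z : R[i]) : n.-primitive_root z -> z^-1 = z ^+ n.-1.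
  move=> pz'; have z0 := prim_root_neq0 pz'.
  by apply: (mulfI z0); rewrite divff // -exprS prednK // prim_expr_order.
have Xq i : (1 <= i <= h)%N -> (X i)%:C%C = (map_poly intr q).[s i (zeta n)].
  move=> ih; have -> : map_poly intr q = 'X + 'X^(n.-1) + 2%:P :> {poly R[i]}.
    by rewrite /q !rmorphD /= map_polyXn map_polyX map_polyC.
  rewrite 2!hornerD hornerX hornerXn hornerC -(zVn _ (pz i ih)) -(conjc_prim_root (pz i ih)).
  by rewrite addcJ addrC /X rmorphD rmorphM /= !rmorph_nat.
have Xinj i j : (1 <= i <= h)%N -> (1 <= j <= h)%N -> X i = X j -> i = j.
  move=> ih jh eX; apply/eqP; apply: contraT => nij.
  have [z1 z2] := aut_selection_separated n0 sel ih jh nij.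
  set a := s i _ in z1 z2; set b := s j _ in z1 z2.
  have a0 : a != 0 := prim_root_neq0 (pz i ih).
  have b0 : b != 0 := prim_root_neq0 (pz j jh).
  have eab : a + a^-1 = b + b^-1.
    rewrite -(conjc_prim_root (pz i ih)) -(conjc_prim_root (pz j jh)) !addcJ.
    by congr (_ * _%:C%C); move: eX; rewrite /X /a /b; lra.
  have : (a - b) * (a * b - 1) = 0.
    transitivity (a * b * ((a + a^-1) - (b + b^-1))); last first.
      by rewrite eab subrr mulr0.
    by field; rewrite a0 b0.
  by move=> /eqP; rewrite mulf_eq0 !subr_eq0 (negbTE z1) (negbTE z2).
(* [B] bounds the conjugates of all the [g i], and rounding [n] coefficients costs at most [n].
   Conjugates of the scaling factor below e / (n + B + 1) thus keep the total error below [e]. *)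
pose B := \sum_i \sum_(j < k) Normc.normc ((map_poly intr (G i)).[s j.+2 (zeta n)]).
have B0 : 0 <= B by do 2![apply: sumr_ge0 => ? _]; rewrite normc_sqn sqrtr_ge0.
have D0 : 0 < n%:R + B + 1 by rewrite ltr_wpDl // addr_ge0 // ler0n.
have ij (j : 'I_k) : (1 <= j.+2 <= h)%N by have := ltn_ord j; rewrite /k; lia.
have [p [p0 sp psmall]] := @small_int_poly R k (fun j => X j.+2) _
  (divr_gt0 e0 D0) (fun j => Re_prim_root_ge (pz _ (ij j))).
pose lam i := (map_poly intr p).[X i].
have lamE i : (1 <= i <= h)%N ->
    (lam i)%:C%C = (map_poly intr (p \Po q)).[s i (zeta n)].
  by move=> ih; rewrite real_complex_horner map_comp_poly horner_comp Xq.
have i1 : (1 <= 1 <= h)%N by [].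
have s1z : s 1%N (zeta n) = zeta n by exact: s1.
have slam i : (1 <= i <= h)%N -> s i (lam 1%N)%:C%C = (lam i)%:C%C.
  move=> ih; rewrite !lamE // s1z.
  by rewrite (cyclotomic_aut_horner _ (cs i ih) zetaK).2.
have lam0 i : (1 <= i <= h)%N -> lam 1%N = 0 -> lam i = 0.
  move=> ih l0; apply: (@complexI R); rewrite -slam // l0.
  by have [_ sD _ _] := cs i ih; rewrite (cyclotomic_field_morph0 sD).
(* Otherwise all [h] conjugates vanish, and the nonzero polynomial [p], of degree at most h - 1, has
   the [h] distinct roots [X i]. *)
have lam1 : lam 1%N != 0.
  apply/eqP => l0.
  have p0R : map_poly intr p != 0 :> {poly R}.
    rewrite map_poly_eq0_id0 ?lead_coef_eq0 //.
    by rewrite intr_eq0 lead_coef_eq0.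
  have := @max_poly_roots _ _ [seq X i | i <- iota 1 h] p0R.
  rewrite size_map size_iota => H.
  suff : (h < size (map_poly intr p : {poly R}))%N.
    have := size_poly (size p) (fun i => (p`_i)%:~R : R).
    rewrite -/(map_poly intr p); move: sp; rewrite /k; lia.
  apply: H.
    apply/allP => _ /mapP[j jh ->]; move: jh; rewrite mem_iota => jh.
    by rewrite rootE; apply/eqP; apply: lam0 => //; lia.
  rewrite map_inj_in_uniq ?iota_uniq // => i j; rewrite !mem_iota => ih jh.
  by apply: Xinj; lia.
have lamn0 i : (1 <= i <= h)%N -> lam i != 0.
  move=> ih; apply: contraNneq lam1 => li0; apply/eqP/(@complexI R).
  have K0 : 0 \in @cyclotomic_field R n.
    by have := (cyclotomic_aut_horner 0 (cs 1%N i1) zetaK).1; rewrite rmorph0 horner0.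
  apply: (cyclotomic_aut_inj (cs i ih)) => //.
    rewrite lamE // s1z.
    exact: (cyclotomic_aut_horner _ (cs i ih) zetaK).1.
  have [_ sD _ _] := cs i ih.
  by rewrite slam // li0 (cyclotomic_field_morph0 sD).
have [||| r rE] := @root_unity_interpolation R n k (fun j => s j.+2 (zeta n))
    (fun j => w 0 j / (lam j.+2)%:C%C).
- by move=> j; apply: pz.
- by move=> j l jl; apply: (aut_selection_separated n0 sel (ij j) (ij l) _).1.
(* For j = l the condition is z_j^2 != 1, true for a primitive root of order n >= 3. *)
- move=> j l; have [<-|jl] := eqVneq j l; last first.
    by apply: (aut_selection_separated n0 sel (ij j) (ij l) _).2.
  rewrite -expr2 -(prim_order_dvd (pz _ (ij j))).
  by apply/negP => /dvdn_leq; lia.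
pose P : {poly int} := \sum_(i < n) Num.floor (r i) *: 'X^i.
have PE (z : R[i]) : (map_poly intr P).[z] = \sum_(i < n) (Num.floor (r i))%:~R * z ^+ i.
  rewrite rmorph_sum /= horner_sum; apply: eq_bigr => i _.
  by rewrite map_polyZ map_polyXn hornerZ hornerXn.
exists (lam 1%N), (t + (lam 1%N)%:C%C * (map_poly intr P).[zeta n]); split=> // i.
rewrite eL -addrA -mulrDr GE.
have zE : (lam 1%N)%:C%C * ((map_poly intr P).[zeta n] + (map_poly intr (G i)).[zeta n])
    = (map_poly intr ((p \Po q) * (P + G i))).[zeta n].
  by rewrite lamE // s1z rmorphM rmorphD /= hornerM hornerD.
rewrite zE; eexists; last by [].
split; first by apply/cyclotomic_ringP; eexists.
apply: eW => j; rewrite /star mxE.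
rewrite (cyclotomic_aut_horner _ (cs _ (ij j)) zetaK).2.
rewrite rmorphM rmorphD /= hornerM hornerD -lamE //.
set Gz := (map_poly intr (G i)).[_].
have lamC : (lam j.+2)%:C%C != 0.
  by rewrite (inj_eq (@complexI R)) lamn0.
have -> : w 0 j = (lam j.+2)%:C%C * \sum_(i < n) (r i)%:C%C * s j.+2 (zeta n) ^+ i.
  by rewrite rE mulrC divfK.
rewrite -mulrBr opprD addrA normrM.
have le : `|\sum_(i < n) (r i)%:C%C * s j.+2 (zeta n) ^+ i
            - (map_poly intr P).[s j.+2 (zeta n)] - Gz| <= (n%:R + B)%:C%C.
  apply: le_trans (ler_normB _ _) _; rewrite rmorphD; apply: lerD.
    rewrite PE -sumrB; apply: le_trans (ler_norm_sum _ _ _) _.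
    rewrite rmorph_nat -[n in _ <= n%:R]card_ord -sumr_const.
    apply: ler_sum => l _; rewrite -mulrBl normrM normrX.
    have -> : `|s j.+2 (zeta n)| = 1.
      by rewrite normc_def -/(sqn _) (sqn_prim_root (pz _ (ij j))) sqrtr1.
    rewrite expr1n mulr1 -(rmorph_int (real_complex R)) -rmorphB /=.
    have /andP[f1 f2] := floor_itv (r l).
    rewrite normc_def /= expr0n addr0 sqrtr_sqr lecR ger0_norm ?subr_ge0 //.
    by rewrite lerBlDr ltW // addrC -intrD1.
  rewrite (_ : `|Gz| = (Normc.normc Gz)%:C%C) // lecR /B (bigD1 i) //= (bigD1 j) //=.
  rewrite -addrA lerDl addr_ge0 //.
    by apply: sumr_ge0 => ? _; rewrite normc_sqn sqrtr_ge0.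
  by do 2![apply: sumr_ge0 => ? _]; rewrite normc_sqn sqrtr_ge0.
apply: le_lt_trans (ler_wpM2l (normr_ge0 _) le) _.
rewrite normc_def /= expr0n addr0 sqrtr_sqr -rmorphM ltcR.
have l0 := psmall j; have nB : 0 <= n%:R + B by rewrite addr_ge0 ?ler0n.
apply: (@le_lt_trans _ _ (e / (n%:R + B + 1) * (n%:R + B))).
  by rewrite ler_wpM2r // ltW.
by rewrite mulrAC ltr_pdivrMr // ltr_pM2l // ltrDl.
Qed.

(** * Construction of affinely regular polygons *)

Lemma crossM (R : realType) (w a b : R[i]) :
  cross (w * a) (w * b) = sqn w * cross a b.
Proof. by case: w a b => ? ? [? ?] [? ?]; rewrite /cross /sqn /=; ring. Qed.

Lemma angleM (R : realType) (w a b : R[i]) :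
  sqn w = 1 -> angle (w * a) (w * b) = angle a b.
Proof.
rewrite /angle !normc_sqn !sqnM => w1; rewrite w1 !mul1r.
congr (acos (_ / _)); case: w a b w1 => w1 w2 [a1 a2] [b1 b2].
rewrite /sqn /= => e.
by transitivity ((w1 ^+ 2 + w2 ^+ 2) * (a1 * b1 + a2 * b2)); [ring|rewrite e mul1r].
Qed.

(* For [d = pi / m] the cross product is [4 sin d sin ((l - 1) d) sin (l d)]. *)
Lemma cross_zeta_gt0 (R : realType) (m l : nat) :
  (1 < l < m)%N -> 0 < cross (zeta m - 1) (zeta m ^+ l - 1 : R[i]).
Proof.
move=> /andP[l1 lm]; pose x : R := pi / m%:R; pose y : R := l.-1%:R * x.
have ex : 2 * pi / m%:R = x *+ 2 :> R by rewrite -[x *+ 2]mulr_natl /x mulrA.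
have el : l%:R * x = x + y by rewrite /y -[in LHS](prednK (ltnW l1)) -natr1; ring.
have ey : l%:R * (2 * pi / m%:R) = x *+ 2 + y *+ 2 :> R.
  by rewrite ex -mulrnDl -el mulrnAr.
have s1 : 0 < sin x.
  by have := @sin_pi_frac_gt0 R m 1; rewrite mul1r; apply; lia.
have s2 : 0 < sin y by apply: sin_pi_frac_gt0; lia.
have s3 : 0 < sin (x + y) by rewrite -el; apply: sin_pi_frac_gt0; lia.
have c2 (z : R) : cos (z *+ 2) = 1 - 2 * sin z ^+ 2.
  by rewrite cos_mulr2n cos2sin2 -[X in X - 1]mulr_natl; ring.
have d2 (z : R) : sin (z *+ 2) = 2 * (cos z * sin z).
  by rewrite sin_mulr2n -[LHS]mulr_natl.
rewrite zetaX /zeta ey ex (cosD (x *+ 2)) (sinD (x *+ 2)) !c2 !d2 /cross /=.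
rewrite sinD in s3; have cx := cos2Dsin2 x.
rewrite [ltRHS](_ : _ =
  4 * (sin x * sin y * (sin x * cos y + cos x * sin y))
  + 8 * sin x ^+ 2 * sin y * cos y * (cos x ^+ 2 + sin x ^+ 2 - 1)); last by ring.
by rewrite cx subrr mulr0 addr0 !mulr_gt0.
Qed.

Definition roots_of_unity (R : realType) (m : nat) (i : 'I_m) : R[i] := zeta m ^+ i.
Arguments roots_of_unity : clear implicits.

Lemma roots_of_unityS (R : realType) (m : nat) (i : 'I_m) :
  roots_of_unity R m (ordS i) = roots_of_unity R m i * zeta m.
Proof.
have m0 : (0 < m)%N by case: m i => // -[].
by rewrite /roots_of_unity /= (prim_expr_mod (zeta_prim R m0)) exprSr.
Qed.

(** Rotating by the inverse of the i-th root reduces to i = 0, with [j] replaced by [l], which is j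
    - i modulo [m]; the two excluded vertices are l = 0 and l = 1. *)
Lemma roots_of_unity_ccw (R : realType) (m : nat) :
  (3 <= m)%N -> ccw_convex (roots_of_unity R m).
Proof.
move=> m3; split=> // i j ji jS; have m0 : (0 < m)%N by lia.
have pz := zeta_prim R m0.
pose l := ((j + (m - i)) %% m)%N.
have vj : roots_of_unity R m j = roots_of_unity R m i * zeta m ^+ l.
  rewrite /roots_of_unity (prim_expr_mod pz) -exprD.
  have -> : (i + (j + (m - i)) = j + m)%N by have := ltn_ord i; lia.
  by rewrite exprD (prim_expr_order pz) mulr1.
have vinj := prim_root_exp_inj pz.
rewrite roots_of_unityS vj -[X in _ * zeta m - X]mulr1 -[X in _ * _ ^+ l - X]mulr1.
rewrite -!mulrBr crossM (sqnX_prim_root _ pz) mul1r.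
apply: cross_zeta_gt0; rewrite ltn_pmod // andbT.
case el : l => [|[|//]].
  by case/eqP: ji; apply: vinj; move: vj; rewrite el mulr1.
by case/eqP: jS; apply: vinj; move: vj; rewrite el expr1 -roots_of_unityS.
Qed.

(** Multiplication by a root of unity is a rotation, so all sides and angles agree with those at the
    vertex 1. *)
Lemma roots_of_unity_regular (R : realType) (m : nat) :
  (3 <= m)%N -> regular_polygon (convex_hull (range (roots_of_unity R m))).
Proof.
move=> m3; have m0 : (0 < m)%N by lia.
have sq1 i : sqn (roots_of_unity R m i) = 1.
  exact: sqnX_prim_root (zeta_prim R m0).
exists m, (roots_of_unity R m); split=> //.
- exact: roots_of_unity_ccw.
- move=> i j; rewrite !roots_of_unityS !normc_sqn.
  have E k : roots_of_unity R m k * zeta m - roots_of_unity R m k =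
     roots_of_unity R m k * (zeta m - 1) by ring.
  by rewrite !E !sqnM !sq1.
- suff E k : angle (roots_of_unity R m k - roots_of_unity R m (ordS k))
     (roots_of_unity R m (ordS (ordS k)) - roots_of_unity R m (ordS k)) =
     angle (1 - zeta m) (zeta m ^+ 2 - zeta m) by move=> /= i j; rewrite !E.
  rewrite !roots_of_unityS -[RHS](angleM _ _ (sq1 k)); congr angle; ring.
Qed.

Lemma sin_zeta_neq0 (R : realType) (n : nat) : (3 <= n)%N -> Im (zeta n : R[i]) != 0.
Proof.
move=> n3; rewrite /zeta /=.
have -> : 2 * pi / n%:R = 2%:R * (pi / n%:R) :> R by rewrite mulrA.
by rewrite gt_eqF // sin_pi_frac_gt0.
Qed.

Lemma zeta_order2 (R : realType) (m j : nat) : (0 < m)%N ->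
  zeta m ^+ j.+2 = (zeta m + (zeta m)^-1) * zeta m ^+ j.+1 - zeta m ^+ j :> R[i].
Proof.
move=> m0; have z0 := prim_root_neq0 (zeta_prim R m0).
by rewrite !exprS; field.
Qed.

(* The linear map sending [1, zeta m] to [1, zeta n] takes every [zeta m ^+ j]
   into [O_n], since these satisfy a second-order recurrence over
   [Z[2 cos (2 pi / m)]]. *)
Lemma model_set_has_gon (R : realType) (m n : nat) (L : set R[i]) :
  (3 <= m)%N -> (3 <= n)%N -> cyclotomic_model_set n L ->
  cyclotomic_ring n (zeta m + (zeta m)^-1 : R[i]) ->
  has_affinely_regular_gon m L.
Proof.
move=> m3 n3 mL tO; have m0 : (0 < m)%N by lia.
have n0 : (0 < n)%N by lia.
have pm := zeta_prim R m0.
pose zm : R[i] := zeta m; pose zn : R[i] := zeta n.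
have sm : Im zm != 0 := sin_zeta_neq0 R m3.
have sn : Im zn != 0 := sin_zeta_neq0 R n3.
(* These coefficients solve lin zm = zn for a map fixing 1; it is invertible since [Im zn] is
   nonzero. *)
pose a01 := (Re zn - Re zm) / Im zm; pose a11 := Im zn / Im zm.
pose lin (z : R[i]) : R[i] := Complex (Re z + a01 * Im z) (a11 * Im z).
have linE (r : R) (x y : R[i]) : lin (r%:C%C * x - y) = r%:C%C * lin x - lin y.
  case: x y => [x1 x2] [y1 y2]; apply/eqP; rewrite eq_complex /lin /=.
  by apply/andP; split; apply/eqP; ring.
have [one_O OB OM] := @cyclotomic_ring_closed R n.
have te : (2 * Re zm)%:C%C = zeta m + (zeta m)^-1.
  by rewrite -(conjc_prim_root pm) addcJ rmorphM rmorph_nat.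
have linO j : cyclotomic_ring n (lin (zm ^+ j)).
  (* The second-order recurrence needs two consecutive powers in the induction. *)
  suff : lin (zm ^+ j) \in cyclotomic_ring n /\ lin (zm ^+ j.+1) \in cyclotomic_ring n.
    by rewrite !inE => -[].
  elim: j => [|j [IH1 IH2]].
    split.
      rewrite expr0 (_ : lin 1 = 1) //.
      by apply/eqP; rewrite eq_complex /lin /= !mulr0 addr0 !eqxx.
    rewrite expr1 (_ : lin zm = zn); first by rewrite inE; move=> S [_]; apply.
    rewrite /lin /a01 /a11 !divfK //.
    by apply/eqP; rewrite eq_complex /= subrKC !eqxx.
  split=> //; rewrite /zm zeta_order2 // -te linE.
  by apply: OB => //; apply: OM => //; rewrite te inE.
have [lam [c [lam0 Lc]]] := model_set_affine_copy n3 mL (fun i : 'I_m => linO i).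
pose A : 'M[R]_2 := \matrix_(i, j)
  if i == 0 then (if j == 0 then lam else lam * a01)
  else (if j == 0 then 0 else lam * a11).
have AE z : affine_map A c z = c + lam%:C%C * lin z.
  rewrite /affine_map !mxE /= addrC; congr (_ + _).
  apply/eqP; rewrite eq_complex /=; apply/andP; split; apply/eqP; ring.
have Au : A \in unitmx.
  rewrite unitmx2 !mxE /= mulr0 subr0 !mulf_neq0 // invr_eq0 //.
pose v := roots_of_unity R m.
have vinj : injective v := prim_root_exp_inj pm.
have Ainj := affine_map_inj (t := c) Au.
have Aseg := affine_map_segment_morph A c.
have vV : vertices (convex_hull (range v)) = range v.
  apply: (vertices_cocircular (c := 0) (r := 1)) => _ [i _ <-].
  by rewrite subr0; exact: sqnX_prim_root pm.
exists (affine_map A c @` convex_hull (range v)); split; split.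
- by exists (convex_hull (range v)), A, c; split=> //; exact: roots_of_unity_regular.
- rewrite vertices_image // vV image_comp.
  by apply: card_range_ord => i j /Ainj /vinj.
- exists (affine_map A c @` range v); last by rewrite convex_hull_image.
  by apply: finite_image; apply: finite_image; exact: finite_finset.
- by rewrite vertices_image // vV => _ [_ [i _ <-] <-]; rewrite AE; exact: Lc.
Qed.

(** * Orders m for which 2 cos (2 pi / m) lies in O_n *)

Lemma zeta_mul (R : realType) (m j : nat) :
  (0 < j)%N -> zeta (j * m) ^+ j = zeta m :> R[i].
Proof.
move=> j0; have jR : j%:R != 0 :> R by rewrite pnatr_eq0; lia.
rewrite zetaX /zeta natrM invfM.
have -> // : j%:R * (2 * pi * (j%:R^-1 * m%:R^-1)) = 2 * pi / m%:R :> R.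
by rewrite mulrCA [j%:R * _]mulrA divff // mul1r.
Qed.

Lemma cyclotomic_ring_zetaX (R : realType) (n j : nat) :
  @cyclotomic_ring R n (zeta n ^+ j).
Proof. by apply/cyclotomic_ringP; exists 'X^j; rewrite map_polyXn hornerXn. Qed.

Lemma cyclotomic_ring_cos (R : realType) (n m : nat) : (0 < m)%N ->
  (forall j, @cyclotomic_ring R n (zeta m ^+ j)) ->
  @cyclotomic_ring R n (zeta m + (zeta m)^-1).
Proof.
move=> m0 H; have pm := zeta_prim R m0.
have -> : (zeta m)^-1 = zeta m ^+ m.-1 :> R[i].
  apply: (mulfI (prim_root_neq0 pm)); rewrite divff ?(prim_root_neq0 pm) //.
  by rewrite -exprS prednK // prim_expr_order.
have [one_O OB _] := @cyclotomic_ring_closed R n.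
have zero_O : 0 \in @cyclotomic_ring R n by rewrite -(subrr 1) OB.
have : zeta m - (0 - zeta m ^+ m.-1) \in @cyclotomic_ring R n.
  by apply: (OB); [have := H 1%N; rewrite expr1 inE|apply: OB => //; rewrite inE].
by rewrite sub0r opprK inE.
Qed.

(** For odd [n] the n-th power of [zeta (2 * n)] is -1, so [zeta (2 * n)] is minus the power of
    [zeta n] with exponent (n + 1)/2. *)
Lemma cyclotomic_ring_double (R : realType) (n j : nat) : odd n ->
  @cyclotomic_ring R n (zeta (2 * n) ^+ j).
Proof.
move=> on; have n0 : (0 < n)%N by case: (n) on.
have pz : (2 * n)%N.-primitive_root (zeta (2 * n) : R[i]).
  by apply: zeta_prim; lia.
have zn : zeta (2 * n) ^+ n = -1 :> R[i].
  have /eqP : (zeta (2 * n) ^+ n) ^+ 2 = 1 :> R[i].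
    by rewrite -exprM (mulnC n 2) (prim_expr_order pz).
  rewrite sqrf_eq1 => /orP[|/eqP //].
  by rewrite -(prim_order_dvd pz) => /dvdn_leq; lia.
have e : zeta (2 * n) = - zeta n ^+ (n.+1)./2 :> R[i].
  rewrite -(zeta_mul R n (isT : (0 < 2)%N)) -exprM.
  have -> : (2 * n.+1./2 = n.+1)%N by lia.
  by rewrite exprS zn mulrN1 opprK.
rewrite e exprNn -exprM; apply/cyclotomic_ringP.
exists ((-1) ^+ j *: 'X^(n.+1./2 * j)).
by rewrite map_polyZ map_polyXn hornerZ hornerXn rmorph_sign.
Qed.

(** The values are -1, 0 and 1. Dividing z^m - 1 = 0 by [z] and by its factors that do not vanish at
    the primitive root z leaves ['Phi_m] at z over z, which is z + 1/z minus the value. *)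
Lemma cyclotomic_ring_cos346 (R : realType) (n m : nat) :
  m \in [:: 3; 4; 6]%N -> @cyclotomic_ring R n (zeta m + (zeta m)^-1).
Proof.
move=> m346; have m0 : (0 < m)%N by move: m346; rewrite !inE => /or3P[] /eqP->.
have pm := zeta_prim R m0; have z0 := prim_root_neq0 pm.
have ne j : (0 < j < m)%N -> zeta m ^+ j - 1 != 0 :> R[i].
  rewrite subr_eq0 -(prim_order_dvd pm) => /andP[j0 jm].
  by apply/negP => /dvdn_leq; lia.
suff [c ec] : exists c : int, zeta m + (zeta m)^-1 = c%:~R :> R[i].
  by apply/cyclotomic_ringP; exists c%:P; rewrite map_polyC hornerC.
have zm := prim_expr_order pm.
move: m346 zm; rewrite !inE => /or3P[] /eqP em zm.
- exists (-1); rewrite em in zm z0 ne *; set z : R[i] := zeta 3 in zm z0 ne *.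
  have z1 := ne 1%N isT; rewrite expr1 in z1.
  rewrite (_ : z + z^-1 = -1 + (z ^+ 3 - 1) / (z * (z - 1))).
    by rewrite zm subrr mul0r addr0.
  by field; rewrite z0 z1.
- exists 0; rewrite em in zm z0 ne *; set z : R[i] := zeta 4 in zm z0 ne *.
  have z2 := ne 2%N isT.
  rewrite (_ : z + z^-1 = (z ^+ 4 - 1) / (z * (z ^+ 2 - 1))).
    by rewrite zm subrr mul0r.
  by field; rewrite z0 z2.
- exists 1; rewrite em in zm z0 ne *; set z : R[i] := zeta 6 in zm z0 ne *.
  have z3 := ne 3%N isT.
  have z2 : z + 1 != 0.
    by have := ne 2%N isT; rewrite subr_sqr_1 mulf_eq0 negb_or => /andP[].
  rewrite (_ : z + z^-1 = 1 + (z ^+ 6 - 1) / (z * (z ^+ 3 - 1) * (z + 1))).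
    by rewrite zm subrr mul0r addr0.
  by field; rewrite z0 z2 z3.
Qed.

(* The classification *)
Local Close Scope classical_set_scope.
Local Close Scope ring_scope.

Theorem corollary4p2 (R : realType) (m n : nat) (Lam : set (complex R))
  (hm : (3 <= m)%N) (hn : (3 <= n)%N) (hn4 : (n %% 4 != 2)%N)
  (hLam : cyclotomic_model_set n Lam) :
  ((n = 3 \/ n = 4) ->
     (has_affinely_regular_gon m Lam <-> m \in [:: 3; 4; 6])) /\
  (setS n ->
     ((n = 8 \/ n = 12) ->
        (has_affinely_regular_gon m Lam <-> m \in [:: 3; 4; 6; n])) /\
     (~ (n = 8 \/ n = 12) ->
        (has_affinely_regular_gon m Lam <-> m \in [:: 3; 4; 6; n; (2 * n)%N]))).
Proof.
have n0 : (0 < n)%N by lia. have m0 : (0 < m)%N by lia.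
have fwd := model_set_gon_order n0 hLam.
have b346 : m \in [:: 3; 4; 6] -> has_affinely_regular_gon m Lam.
  by move=> h; apply: model_set_has_gon hm hn hLam _; exact: cyclotomic_ring_cos346.
have bn : m = n -> has_affinely_regular_gon m Lam.
  move=> h; apply: model_set_has_gon hm hn hLam _.
  by apply: cyclotomic_ring_cos => // j; rewrite h; exact: cyclotomic_ring_zetaX.
have b2n : odd n -> m = (2 * n)%N -> has_affinely_regular_gon m Lam.
  move=> on h; apply: model_set_has_gon hm hn hLam _.
  by apply: cyclotomic_ring_cos => // j; rewrite h; exact: cyclotomic_ring_double.
have dvdE a b s : (0 < b)%N -> divisors b = s -> (a %| b)%N -> a \in s.
  by move=> b0 <-; rewrite -dvdn_divisors.
split; last split.
- case=> en; subst n; split=> // /fwd[//|mn|[d /andP[od dn] md]].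
  + by have := dvdE _ 3 [:: 1; 3]%N isT erefl mn; rewrite !inE; lia.
  + by have := dvdE _ 3 [:: 1; 3]%N isT erefl dn; rewrite !inE; lia.
  + by have := dvdE _ 4 [:: 1; 2; 4]%N isT erefl mn; rewrite !inE; lia.
  + by have := dvdE _ 4 [:: 1; 2; 4]%N isT erefl dn; rewrite !inE; lia.
- case=> en; subst n; split=> [/fwd[h|mn|[d /andP[od dn] md]]|h].
  + by move: h; rewrite !inE; lia.
  + by have := dvdE _ 8 [:: 1; 2; 4; 8]%N isT erefl mn; rewrite !inE; lia.
  + by have := dvdE _ 8 [:: 1; 2; 4; 8]%N isT erefl dn; rewrite !inE; lia.
  + have [/b346 //|/bn //] : m \in [:: 3; 4; 6] \/ m = 8.
    by move: h; rewrite !inE; lia.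
  + by move: h; rewrite !inE; lia.
  + by have := dvdE _ 12 [:: 1; 2; 3; 4; 6; 12]%N isT erefl mn; rewrite !inE; lia.
  + by have := dvdE _ 12 [:: 1; 2; 3; 4; 6; 12]%N isT erefl dn; rewrite !inE; lia.
  + have [/b346 //|/bn //] : m \in [:: 3; 4; 6] \/ m = 12.
    by move: h; rewrite !inE; lia.
- move=> n812.
  (* Here [n] is 9 or an odd prime. The divisors 1, 3, n give m = 3 or n directly and m = 6 or 2n
     after doubling, while m = 1 and m = 2 are too small. *)
  have [on nd] : odd n /\
      forall a, (a %| n)%N -> [\/ a = 1%N, a = 3 | a = n].
    case: H => [|[p /andP[pp pr] en]].
      rewrite !inE => h; have en : n = 9 by lia.
      subst n; split=> // a /(dvdE _ 9 [:: 1; 3; 9]%N isT erefl).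
      by rewrite !inE => /or3P[] /eqP ->; [apply: Or31|apply: Or32|apply: Or33].
    rewrite -en in pr; split; first by rewrite en /= mul2n odd_double.
    move=> a /(primeP pr).2 /orP[] /eqP ->; by [apply: Or31|apply: Or33].
  split=> [/fwd[h|/nd mn|[d /andP[od /nd dn] md]]|h].
  + by move: h; rewrite !inE; lia.
  + by case: mn; rewrite !inE; lia.
  + by case: dn; rewrite !inE; lia.
  + have [/b346 //|[/bn //|/(b2n on) //]] :
      m \in [:: 3; 4; 6] \/ m = n \/ m = (2 * n)%N.
    by move: h; rewrite !inE; lia.
Qed.
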